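(* Let $K$ be a knot or link diagram with $n$ crossings, numbered $1,\dots,n$, and let $V$ be a Frobenius algebra. Let $F$ be the functor from the $n$-cube category to modules obtained by applying $V$ to the bracket states of $K$, extended to a functor $F$ on the $n$-simplex category $\mathrm{Cat}[n]$. Then the Khovanov homology of $K$, defined as $KhoH_*(K)=H_*(F(\nabla[n]))$, satisfies $$KhoH_*(K)=H_*(F(\nabla[n]))\;\cong\;H_*\bigl(F(\mathrm{Nerve}\,\mathrm{Cat}[n])\bigr)\;\cong\;H_*(\mathrm{Cat}[n],F).$$ That is, Khovanov homology is the homology of a small category with coefficients in a functor, and thereby the homology of a simplicial object.
   Context: States. Each crossing of $K$ can be smoothed in two ways, type $A$ and type $B$ (the Kauffman bracket expands a crossing as $A$ times the $A$-smoothing plus $A^{-1}$ times the $B$-smoothing). A word $v\in\{A,B\}^n$ determines a state $S_v$: the collection of planar circles obtained by smoothing crossing $j$ according to the $j$-th letter of $v$. Cube category. $\mathcal D^n=\{A,B\}^n$ has as objects the words of length $n$ in $A,B$. Its generating morphisms change a single letter $A$ to $B$; it is equivalent to the poset category of subsets of $\{1,\dots,n\}$. Functor on the cube category. $V$ is a module over a ground ring with unit, with maps $m:V\otimes V\to V$ and $\Delta:V\to V\otimes V$ defining a Frobenius algebra structure, so that the maps below are independent of the factorization of a morphism into generating morphisms. A relevant example is $V=k[x]/(x^2)$ with $m(x\otimes1)=m(1\otimes x)=x$, $m(1\otimes 1)=1$, $m(x\otimes x)=0$, $\Delta(1)=1\otimes x+x\otimes1$, $\Delta(x)=x\otimes x$.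 $F(v)$ is the tensor product of one copy of $V$ for each circle of $S_v$. A generating morphism $v\to v'$ re-smooths one crossing, which merges two circles into one or splits one circle into two; $F(v\to v')$ applies $m$ or $\Delta$ accordingly to the factors involved and the identity to the other factors. Simplex category and extension of $F$. $\mathrm{Cat}[n]$ is the category generated by the abstract simplex $\langle0,1,\dots,n\rangle$ and its face maps. Its objects are the faces (nonempty subsets of $\{0,\dots,n\}$), with one morphism $\sigma\to\tau$ when $\tau\subseteq\sigma$ and none otherwise. The cube category embeds in it by sending a word $v$ to the face $\{0\}\cup\{j:\text{the }j\text{-th letter of }v\text{ is }A\}$; each $B$ is an eliminated vertex. The functor is extended by $0$ to the faces not containing the vertex $0$, so that deleting the vertex $0$ induces the zero map. $F(\nabla[n])$. $\nabla[n]$ is the pre-simplicial set (face maps, no degeneracies) of faces of $\langle0,\dots,n\rangle$. $F(\nabla[n])$ is the pre-simplicial module induced by $F$: its $k$-th level is $\bigoplus_vF(v)$ over words $v$ with exactly $k$ letters $A$. For $0\le i\le k$, the face operator $d_i$ is zero for $i=0$, and for $i\ge1$ it acts on $F(v)$ by $F(v\to v')$, where $v'$ is obtained by replacing the $i$-th $A$ of $v$ by $B$. Its homology is that of the chain complex with boundary $\sum_i(-1)^id_i$. (The homological degree here counts letters $A$, dually to the usual convention of counting letters $B$.) Homology of a small category $C$ with coefficients in a functor $F$ from $C$ to a module category. Sequences of composable morphisms are extended one step to the left by a terminal object $A_{-1}=T$ that $F$ sends to a one-dimensional module $F(T)$, so that a morphism $F(T)\to F(A_0)$ amounts to an element $\lambda\in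 F(A_0)$. A $p$-simplex of $F(\mathrm{Nerve}\,C)$ is thus a symbol $\gamma=\langle\lambda;g_0,\dots,g_{p-1}\rangle$, where $g_j=F(f_j)$ for composable morphisms $f_j:A_j\to A_{j+1}$ of $C$ and $\lambda\in F(A_0)$. The faces are $d_0\gamma=\langle g_0(\lambda);g_1,\dots,g_{p-1}\rangle$; $d_j\gamma=\langle\lambda;g_0,\dots,g_{j-2},g_j\circ g_{j-1},\dots,g_{p-1}\rangle$ for $0<j<p$; $d_p\gamma=\langle\lambda;g_0,\dots,g_{p-2}\rangle$. Degeneracies insert identity morphisms. By definition the symbol is identified with the sequence $\langle\lambda_0,\dots,\lambda_p\rangle$, where $\lambda_0=\lambda$ and $\lambda_j=g_{j-1}\circ\dots\circ g_0(\lambda)$; two symbols are regarded as equal when these sequences of module elements agree term by term. The associated simplicial module, written $ZF(\mathrm{Nerve}\,C)$ or simply $F(\mathrm{Nerve}\,C)$, is in each degree the free (abelian) module generated by these simplices. $H_*(C,F)=H_*(F(\mathrm{Nerve}\,C))$ is by definition its homology, with boundary the alternating sum of the face maps.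
   Formalization: F(Nerve C) is taken as the module generated by the symbols ⟨λ;g⟩ subject to linearity in λ (same g), not the free module on the set of symbols; with the free module the claim fails, e.g. for the crossingless unknot with V=F₂[x]/(x²). *)

(* Defs.v *)
From HB Require Import structures.
From mathcomp Require Import all_boot all_algebra.
From mathcomp Require Import boolp.
From mathcomp Require Import freeg.
Set Implicit Arguments.
Unset Strict Implicit.
Unset Printing Implicit Defensive.
Import GRing.Theory.
Local Open Scope ring_scope.
Local Open Scope quotient_scope.

Inductive span (R : pzRingType) (M : lmodType R) (S : M -> Prop) : M -> Prop :=
| span0 : span S 0
| spanD a x y : S x -> span S y -> span S (a *: x + y).

Section Quotient.
Variables (R : pzRingType) (M : lmodType R) (S : M -> Prop).

Lemma span_gen x : S x -> span S x.
Proof.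
by move=> Sx; rewrite -[x]addr0 -[x]scale1r; apply: spanD Sx (span0 _).
Qed.

Lemma span_add x y : span S x -> span S y -> span S (x + y).
Proof.
move=> + Sy; elim=> [|a u v Su _ IH]; first by rewrite add0r.
by rewrite -addrA; apply: spanD.
Qed.

Lemma span_scale a x : span S x -> span S (a *: x).
Proof.
elim=> [|b u v Su _ IH]; first by rewrite scaler0; apply: span0.
by rewrite scalerDr scalerA; apply: spanD.
Qed.

Lemma span_opp x : span S x -> span S (- x).
Proof. by rewrite -scaleN1r; apply: span_scale. Qed.

Definition eqmod (x y : M) : bool := `[< span S (x - y) >].

Lemma eqmod_equiv : equiv_class_of eqmod.
Proof.
split=> [x|x y|y x z].
- by apply/asboolP; rewrite subrr; apply: span0.
- by apply/asboolP/asboolP => /span_opp; rewrite opprB.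
- move=> /asboolP xy /asboolP yz; apply/asboolP.
  by rewrite -[x](subrK y) -addrA; apply: span_add.
Qed.
Canonical eqmod_equivRel := EquivRelPack eqmod_equiv.

Definition quot := {eq_quot eqmod}.
HB.instance Definition _ := Choice.on quot.

Definition proj (x : M) : quot := \pi_({eq_quot eqmod}) x.
Definition rep (q : quot) : M := repr (q : {eq_quot eqmod}).

Lemma repK : cancel rep proj.
Proof. by move=> q; rewrite /proj /rep reprK. Qed.

Lemma projP x y : proj x = proj y <-> span S (x - y).
Proof.
by split=> [/eqquotP/asboolP|/asboolP h]; last exact/eqquotP.
Qed.

Lemma rep_proj x : span S (rep (proj x) - x).
Proof. by apply/projP; rewrite repK. Qed.

Definition quot_add (x y : quot) : quot := proj (rep x + rep y).
Definition quot_opp (x : quot) : quot := proj (- rep x).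
Definition quot_scale a (x : quot) : quot := proj (a *: rep x).

Lemma quot_ind (P : quot -> Prop) : (forall x, P (proj x)) -> forall q, P q.
Proof. by move=> h q; rewrite -[q]repK; apply: h. Qed.

Lemma quot_addE x y : quot_add (proj x) (proj y) = proj (x + y).
Proof.
by apply/projP; rewrite opprD addrACA; apply: span_add; apply: rep_proj.
Qed.

Lemma quot_oppE x : quot_opp (proj x) = proj (- x).
Proof. by apply/projP; rewrite -opprD; apply/span_opp/rep_proj. Qed.

Lemma quot_scaleE a x : quot_scale a (proj x) = proj (a *: x).
Proof. by apply/projP; rewrite -scalerBr; apply/span_scale/rep_proj. Qed.

Lemma quot_addA : associative quot_add.
Proof.
elim/quot_ind=> x; elim/quot_ind=> y; elim/quot_ind=> z.
by rewrite !quot_addE addrA.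
Qed.

Lemma quot_addC : commutative quot_add.
Proof.
by elim/quot_ind=> x; elim/quot_ind=> y; rewrite !quot_addE addrC.
Qed.

Lemma quot_add0 : left_id (proj 0) quot_add.
Proof. by elim/quot_ind=> x; rewrite quot_addE add0r. Qed.

Lemma quot_addN : left_inverse (proj 0) quot_opp quot_add.
Proof. by elim/quot_ind=> x; rewrite quot_oppE quot_addE addNr. Qed.

HB.instance Definition _ :=
  GRing.isZmodule.Build quot quot_addA quot_addC quot_add0 quot_addN.

Lemma quot_scaleA a b v : quot_scale a (quot_scale b v) = quot_scale (a * b) v.
Proof. by elim/quot_ind: v => x; rewrite !quot_scaleE scalerA. Qed.

Lemma quot_scale1 : left_id 1 quot_scale.
Proof. by elim/quot_ind=> x; rewrite quot_scaleE scale1r. Qed.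

Lemma quot_scaleDr : right_distributive quot_scale +%R.
Proof.
move=> a; elim/quot_ind=> x; elim/quot_ind=> y.
by rewrite quot_scaleE [_ + _]quot_addE !quot_scaleE [RHS]quot_addE scalerDr.
Qed.

Lemma quot_scaleDl v : {morph quot_scale^~ v : a b / a + b}.
Proof.
move=> a b; elim/quot_ind: v => x.
by rewrite !quot_scaleE [RHS]quot_addE scalerDl.
Qed.

HB.instance Definition _ := GRing.Zmodule_isLmodule.Build R quot
  quot_scaleA quot_scale1 quot_scaleDr quot_scaleDl.

Lemma proj_linear : linear proj.
Proof.
move=> a x y; rewrite -[RHS]/(quot_add (quot_scale a (proj x)) (proj y)).
by rewrite quot_scaleE quot_addE.
Qed.
HB.instance Definition _ := GRing.isLinear.Build R M quot *:%R proj proj_linear.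

End Quotient.

Section QuotientMap.
Variables (R : pzRingType) (M N : lmodType R).
Variables (S : M -> Prop) (S' : N -> Prop) (f : {linear M -> N}).
Hypothesis fS : forall x, S x -> span S' (f x).

Lemma span_map x : span S x -> span S' (f x).
Proof.
elim=> [|a u v Su _ IH]; first by rewrite linear0; apply: span0.
by rewrite linearP; apply: span_add IH; apply/span_scale/fS.
Qed.

Definition quot_map_fun (q : quot S) : quot S' := proj S' (f (rep q)).

Lemma quot_map_funE x : quot_map_fun (proj S x) = proj S' (f x).
Proof. by apply/projP; rewrite -linearB; apply/span_map/rep_proj. Qed.

Lemma quot_map_linear : linear quot_map_fun.
Proof.
move=> a; elim/quot_ind=> x; elim/quot_ind=> y.
by rewrite -linearP !quot_map_funE !linearP.
Qed.
HB.instance Definition _ :=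
  GRing.isLinear.Build R (quot S) (quot S') *:%R quot_map_fun quot_map_linear.
Definition quot_map : {linear quot S -> quot S'} := quot_map_fun.
End QuotientMap.

Definition lmod_iso (R : pzRingType) (M N : lmodType R) : Prop :=
  exists f : {linear M -> N}, bijective f.

Section Tensor.
Variables (R : comNzRingType) (I : finType) (V : lmodType R).
Implicit Types x : {ffun I -> V}.

Definition upd x i u : {ffun I -> V} := [ffun j => if j == i then u else x j].

Definition multilinear (W : lmodType R) (f : {ffun I -> V} -> W) : Prop :=
  forall x i a u w,
    f (upd x i (a *: u + w)) = a *: f (upd x i u) + f (upd x i w).

Definition tensor_rel (z : {freeg {ffun I -> V} / R}) : Prop :=
  exists x i a u w,
    z = << upd x i (a *: u + w) >>
        - (a *: << upd x i u >> + << upd x i w >>).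

Definition tensor := quot tensor_rel.
HB.instance Definition _ := GRing.Lmodule.on tensor.

Definition pure x : tensor := proj tensor_rel << x >>.

(* The extension of f from pure tensors to all tensors; it is meaningful when
   f is multilinear, see tlift_pure and tlift_linear below. *)
Definition tlift (W : lmodType R) (f : {ffun I -> V} -> W) (t : tensor) : W :=
  fglift f (rep t).

End Tensor.

Section FreeLift.
Variables (R : comNzRingType) (K : choiceType) (W : lmodType R) (f : K -> W).

Lemma free_ind (P : {freeg K / R} -> Prop) :
  P 0 -> (forall a k z, P z -> P (a *: << k >> + z)) -> forall z, P z.
Proof.
move=> P0 PD; elim/freeg_ind_dom0 => // a k z _ _ /(PD a k).
by congr P; congr (_ + _); apply/eqP/freeg_eqP=> j;
  rewrite coeffZ !coeffU mul1r.
Qed.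

Lemma fglift_gen k : fglift f << k >> = f k.
Proof. by rewrite liftU scale1r. Qed.

Lemma fglift_linear : linear (fglift f : {freeg K / R} -> W).
Proof.
have fB : {morph (fglift f : {freeg K / R} -> W) : x y / x - y}.
  exact: lift_is_additive.
have f0 : fglift f (0 : {freeg K / R}) = 0 by rewrite -(subrr 0) fB subrr.
have fN : {morph (fglift f : {freeg K / R} -> W) : x / - x}.
  by move=> x; rewrite -sub0r fB f0 sub0r.
have fD : {morph (fglift f : {freeg K / R} -> W) : x y / x + y}.
  by move=> x y; rewrite -[y]opprK fB fN !opprK.
move=> a x y; rewrite fD; congr (_ + _).
elim/free_ind: x => [|b k z IH]; first by rewrite scaler0 f0 scaler0.
have fZ c : fglift f (c *: << k >> : {freeg K / R}) = c *: f k.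
  have -> : c *: << k >> = << c *g k >> :> {freeg K / R}.
    by apply/eqP/freeg_eqP=> j; rewrite coeffZ !coeffU mul1r.
  by rewrite liftU.
by rewrite scalerDr !fD IH scalerA !fZ scalerDr scalerA.
Qed.
HB.instance Definition _ :=
  GRing.isLinear.Build R {freeg K / R} W *:%R (fglift f) fglift_linear.
Definition flift : {linear {freeg K / R} -> W} := fglift f.
End FreeLift.

Section TensorTheory.
Variables (R : comNzRingType) (I : finType) (V W : lmodType R).
Variable f : {ffun I -> V} -> W.
Hypothesis f_mult : multilinear f.

Lemma tlift_proj z : tlift f (proj (@tensor_rel R I V) z) = flift f z.
Proof.
rewrite /tlift; apply/eqP; rewrite -subr_eq0 -linearB; apply/eqP.
elim: (rep_proj (@tensor_rel R I V) z) => [|a u v]; first exact: linear0.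
move=> [x [i [b [r [s ->]]]]] _ IH; rewrite linearP IH addr0.
rewrite linearB linearD linearZ /= !fglift_gen f_mult subrr.
exact: scaler0.
Qed.

Lemma tlift_linear : linear (tlift f).
Proof.
move=> a; elim/quot_ind=> x; elim/quot_ind=> y.
by rewrite -[_ + _]linearP !tlift_proj linearP.
Qed.

Lemma tlift_pure x : tlift f (pure x) = f x.
Proof. by rewrite tlift_proj; apply: fglift_gen. Qed.
End TensorTheory.

Section Frobenius.
Variables (R : comNzRingType) (V : comAlgType R).

Definition pair2 (a b : V) : {ffun 'I_2 -> V} :=
  [ffun i : 'I_2 => if val i == 0 then a else b].
Definition triple3 (a b c : V) : {ffun 'I_3 -> V} :=
  [ffun i : 'I_3 => if val i == 0 then a else if val i == 1 then b else c].

Notation i0 := (ord0 : 'I_2).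
Notation i1 := (ord_max : 'I_2).
Notation VV := (tensor 'I_2 V).
Notation VVV := (tensor 'I_3 V).

(* Commutativity is part of the notion: the tensor factors are indexed by the
   unordered set of circles of a state.  Cocommutativity follows from the
   axioms below. *)
Record frobenius := Frobenius {
  Delta : {linear V -> VV};
  counit : {linear V -> R^o};
  counitl : forall a, tlift (fun x => counit (x i0) *: x i1) (Delta a) = a;
  counitr : forall a, tlift (fun x => counit (x i1) *: x i0) (Delta a) = a;
  coassoc : forall a,
    tlift (fun x => tlift (fun y => pure (triple3 (y i0) (y i1) (x i1)))
                          (Delta (x i0))) (Delta a) =
    tlift (fun x => tlift (fun y => pure (triple3 (x i0) (y i0) (y i1)))
                          (Delta (x i1))) (Delta a) :> VVV;
  frobl : forall a b,
    Delta (a * b) = tlift (fun x => pure (pair2 (a * x i0) (x i1))) (Delta b);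
  frobr : forall a b,
    Delta (a * b) = tlift (fun x => pure (pair2 (x i0) (x i1 * b))) (Delta a)
}.
End Frobenius.

(* The four ends at crossing c are the darts (c, 0), ..., (c, 3), listed
   counterclockwise; (c, 0), (c, 2) lie on the underpassing strand and
   (c, 1), (c, 3) on the overpassing one. *)
Definition dart n : finType := ('I_n * 'I_4)%type.

Definition turn n (x : dart n) : dart n := (x.1, x.2 + 1).

(* The edges of the diagram join the darts in pairs; in addition there are
   [loops] closed components without crossings.  The last condition is
   V - E + F = 2 C with V = n and E = 2 n, where the faces F are the cycles of
   [turn \o glue] and C is the number of connected components of the 4-valent
   graph: it says that the rotation system given by [turn] is planar. *)
Record diagram n := Diagram {
  glue : dart n -> dart n;
  glueK : involutive glue;
  glue_neq : forall x, glue x != x;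
  loops : nat;
  diagram_planar :
    fcard (@turn n \o glue) (dart n) =
    (n + 2 * n_comp [rel x y | (y == glue x) || (y == turn x)] (dart n))%N
}.

(* true stands for the letter A, false for B *)
Definition word n : finType := {ffun 'I_n -> bool}.
Definition nA n (v : word n) : nat := #|[set j | v j]|.

Definition wle n (v v' : word n) : bool := [forall j, v' j ==> v j].

Definition eraseA n (v : word n) (c : 'I_n) : word n :=
  [ffun j => if j == c then false else v j].

(* The A-smoothing joins the two regions swept by the overpassing strand when
   it turns counterclockwise, so its arcs are 0-1 and 2-3; those of the
   B-smoothing are 1-2 and 3-0. *)
Definition smooth n (v : word n) (x : dart n) : dart n :=
  (x.1, if v x.1 == odd x.2 then x.2 - 1 else x.2 + 1).

Section States.
Variables (n : nat) (K : diagram n).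

Definition strand (v : word n) : rel (dart n) :=
  [rel x y | (y == glue K x) || (y == smooth v x)].

Definition is_block (v : word n) (C : {set dart n}) : bool :=
  [exists x, C == [set y | connect (strand v) x y]].

(* the circles of S_v that meet a crossing, as sets of darts *)
Definition block (v : word n) : finType := {C : {set dart n} | is_block v C}.

Definition circle (v : word n) : finType := (block v + 'I_(loops K))%type.

Definition same_circle v v' (e : circle v) (e' : circle v') : bool :=
  match e, e' with
  | inl C, inl C' => val C == val C'
  | inr l, inr l' => l == l'
  | _, _ => false
  end.
End States.

Record smallCat := SmallCat {
  ob : Type;
  hom : ob -> ob -> Type;
  idm : forall a, hom a a;
  cmp : forall a b c, hom a b -> hom b c -> hom a c;
  cmp_idl : forall a b (f : hom a b), cmp (idm a) f = f;
  cmp_idr : forall a b (f : hom a b), cmp f (idm b) = f;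
  cmpA : forall a b c d (f : hom a b) (g : hom b c) (h : hom c d),
    cmp f (cmp g h) = cmp (cmp f g) h
}.
Arguments hom : clear implicits.
Arguments idm : clear implicits.

Record modFunctor (R : comNzRingType) (C : smallCat) := ModFunctor {
  fob : ob C -> lmodType R;
  fmap : forall a b, hom C a b -> {linear fob a -> fob b};
  fmap_id : forall a x, fmap (idm C a) x = x;
  fmap_cmp : forall a b c (f : hom C a b) (g : hom C b c) x,
    fmap (cmp f g) x = fmap g (fmap f x)
}.

Arguments fmap {R C} m {a b} : rename.
Arguments fmap_id {R C} m {a} x : rename.
Arguments fmap_cmp {R C} m {a b c} f g x : rename.

Section PosetCat.
Variables (T : Type) (le : T -> T -> bool).
Hypotheses (le_refl : forall a, le a a)
           (le_tr : forall a b c, le a b -> le b c -> le a c).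

Definition posetCat : smallCat.
Proof.
by refine (@SmallCat T (fun a b => is_true (le a b)) le_refl le_tr _ _ _);
  move=> *; apply: bool_irrelevance.
Defined.
End PosetCat.

Lemma wle_refl n (v : word n) : wle v v.
Proof. by apply/forallP=> j; apply: implybb. Qed.

Lemma wle_trans n (u v w : word n) : wle u v -> wle v w -> wle u w.
Proof.
move=> /forallP uv /forallP vw; apply/forallP=> j.
by apply/implyP=> /(implyP (vw j))/(implyP (uv j)).
Qed.

Definition cube n : smallCat := posetCat (@wle_refl n) (@wle_trans n).

Definition face n := {s : {set 'I_n.+1} | s != set0}.

(* the morphisms sigma -> tau are the inclusions of tau as a face of sigma *)
Definition fle n (s t : face n) : bool := val t \subset val s.

Lemma fle_refl n (s : face n) : fle s s.
Proof. exact: subxx. Qed.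

Lemma fle_trans n (s t u : face n) : fle s t -> fle t u -> fle s u.
Proof. by move=> st tu; apply: subset_trans st. Qed.

Definition Cat n : smallCat := posetCat (@fle_refl n) (@fle_trans n).

Section StateFunctor.
Variables (R : comNzRingType) (V : comAlgType R) (fr : frobenius V).
Variables (n : nat) (K : diagram n).

Definition state_module (v : word n) : lmodType R := tensor (circle K v) V.

Definition merge_rule v v' (g : state_module v -> state_module v') : Prop :=
  forall (a b : block K v) (c : block K v'),
    a != b -> val c = val a :|: val b ->
  forall (x : {ffun circle K v -> V}) (y : {ffun circle K v' -> V}),
    y (inl c) = x (inl a) * x (inl b) ->
    (forall e e', same_circle e e' -> y e' = x e) ->
  g (pure x) = pure y.

Definition split_rule v v' (g : state_module v -> state_module v') : Prop :=
  forall (a : block K v) (b c : block K v'),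
    b != c -> val a = val b :|: val c ->
  forall (x : {ffun circle K v -> V}) (y : V -> V -> {ffun circle K v' -> V}),
    (forall s t, y s t (inl b) = s) ->
    (forall s t, y s t (inl c) = t) ->
    (forall s t e e', same_circle e e' -> y s t e' = x e) ->
  g (pure x) = tlift (fun z => pure (y (z ord0) (z ord_max)))
                     (Delta fr (x (inl a))).

(* The functor F on the cube category: on objects it is [state_module], and
   the two rules determine it on the generating morphisms, hence everywhere,
   pure tensors being generators.  Planarity leaves only merges and splits. *)
Record stateFunctor := StateFunctor {
  smap : forall v v', wle v v' -> {linear state_module v -> state_module v'};
  smap_id : forall v (h : wle v v) x, smap h x = x;
  smap_cmp : forall u v w (h : wle u v) (k : wle v w) (l : wle u w) x,
    smap l x = smap k (smap h x);
  smap_gen : forall v c (h : wle v (eraseA v c)), v c ->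
    merge_rule (smap h) /\ split_rule (smap h)
}.

Definition functor_of_states (F : stateFunctor) : modFunctor R (cube n) :=
  @ModFunctor R (cube n) state_module (fun v v' h => smap F h)
    (fun v x => smap_id F _ x) (fun u v w h k x => smap_cmp F h k _ x).
Coercion functor_of_states : stateFunctor >-> modFunctor.
End StateFunctor.

Section OnlyIf.
Variable R : comNzRingType.

Definition only_if (b : bool) (M : lmodType R) : lmodType R :=
  if b then M else 'rV[R]_0.

Definition only_if_map b b' (M N : lmodType R) (f : {linear M -> N}) :
    {linear only_if b M -> only_if b' N} :=
  match b, b' with
  | true, true => f
  | true, false => \0
  | false, true => \0
  | false, false => \0
  end.
End OnlyIf.

(* Vertex j.+1 of the simplex corresponds to the crossing j : 'I_n. *)
Definition word_of_face n (s : face n) : word n :=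
  [ffun j : 'I_n => fintype.lift ord0 j \in val s].

Lemma word_of_face_le n (s t : face n) :
  fle s t -> wle (word_of_face s) (word_of_face t).
Proof.
by move=> /subsetP ts; apply/forallP=> j; rewrite !ffunE; apply/implyP/ts.
Qed.

Section Extension.
Variables (R : comNzRingType) (n : nat) (F : modFunctor R (cube n)).

Definition ext_ob (s : face n) : lmodType R :=
  only_if (ord0 \in val s) (fob F (word_of_face s)).

Definition ext_map (s t : face n) (h : fle s t) :
    {linear ext_ob s -> ext_ob t} :=
  only_if_map (ord0 \in val s) (ord0 \in val t)
    (fmap F (word_of_face_le h : hom (cube n) _ _)).

Lemma ext_map_id (s : face n) (h : fle s s) x : ext_map h x = x.
Proof.
move: x; rewrite /ext_map /ext_ob; case: (ord0 \in val s) => /= x.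
  rewrite -[RHS](fmap_id F); congr (fmap F _ x).
  exact: bool_irrelevance.
by apply/rowP; case.
Qed.

Lemma ext_map_cmp (s t u : face n) (h : fle s t) (k : fle t u) (l : fle s u) x :
  ext_map l x = ext_map k (ext_map h x).
Proof.
move: x; rewrite /ext_map /ext_ob.
have kh : (ord0 \in val u) ==> (ord0 \in val t) by apply/implyP/(subsetP k).
have hh : (ord0 \in val t) ==> (ord0 \in val s) by apply/implyP/(subsetP h).
move: kh hh; case: (ord0 \in val u); case: (ord0 \in val t);
  case: (ord0 \in val s) => //= _ _ x.
rewrite -(fmap_cmp F); congr (fmap F _ x).
exact: bool_irrelevance.
Qed.

Definition extend : modFunctor R (Cat n) :=
  @ModFunctor R (Cat n) ext_ob (fun s t h => @ext_map s t h)
    (fun s x => ext_map_id _ x) (fun s t u h k x => ext_map_cmp h k _ x).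
End Extension.

Record preSimplicial (R : pzRingType) := PreSimplicial {
  lev : nat -> lmodType R;
  fac : forall p, 'I_p.+2 -> {linear lev p.+1 -> lev p};
  fac_fac : forall p (i j : 'I_p.+2) (i' j' : 'I_p.+3) x,
    val i' = val i -> val j' = (val j).+1 -> (i <= j)%N ->
    fac i (fac j' x) = fac j (fac i' x)
}.

Section Homology.
Variables (R : pzRingType) (X : preSimplicial R).

Definition bd p (x : lev X p.+1) : lev X p :=
  \sum_(i < p.+2) (-1) ^+ i *: fac X i x.

Lemma bd_linear p : linear (@bd p).
Proof.
move=> a x y; rewrite /bd scaler_sumr -big_split; apply: eq_bigr => i _ /=.
rewrite linearP scalerDr; congr (_ + _).
by rewrite !scalerA; congr (_ *: _); apply/esym/commr_sign.
Qed.
HB.instance Definition _ p :=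
  GRing.isLinear.Build R (lev X p.+1) (lev X p) *:%R (@bd p) (@bd_linear p).

Definition is_cycle p : pred (lev X p) :=
  match p return pred (lev X p) with
  | 0 => predT
  | p'.+1 => [pred x | bd x == 0]
  end.

Lemma is_cycle_submod p : submod_closed (@is_cycle p).
Proof.
case: p => [|p]; split=> //; first by apply/eqP; apply: linear0.
move=> a x y /eqP x0 /eqP y0; apply/eqP.
by rewrite bd_linear x0 y0 scaler0 addr0.
Qed.
HB.instance Definition _ p :=
  GRing.isSubmodClosed.Build R (lev X p) (@is_cycle p) (@is_cycle_submod p).

Record cycles p := Cycle { cyc : lev X p; cycP : cyc \in @is_cycle p }.
HB.instance Definition _ p := [isSub for @cyc p].
HB.instance Definition _ p := [Choice of cycles p by <:].
HB.instance Definition _ p :=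
  [SubChoice_isSubLmodule of cycles p by <:].

Definition is_boundary p (z : cycles p) : Prop :=
  exists y : lev X p.+1, cyc z = bd y.

Definition homology p : lmodType R := quot (@is_boundary p).
End Homology.

(* A simplicial module as a contravariant functor on the category of the
   finite ordinals [p] = 'I_p.+1 and their nondecreasing maps. *)
Definition mono p q (t : 'I_q.+1 -> 'I_p.+1) : Prop :=
  forall i j : 'I_q.+1, (i <= j)%N -> (t i <= t j)%N.

Record simplicial (R : pzRingType) := Simplicial {
  slev : nat -> lmodType R;
  act : forall p q (t : 'I_q.+1 -> 'I_p.+1), mono t ->
    {linear slev p -> slev q};
  act_id : forall p (t : 'I_p.+1 -> 'I_p.+1) (h : mono t) x,
    t =1 id -> act h x = x;
  act_cmp : forall p q r (t : 'I_q.+1 -> 'I_p.+1) (u : 'I_r.+1 -> 'I_q.+1)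
      (v : 'I_r.+1 -> 'I_p.+1) (ht : mono t) (hu : mono u) (hv : mono v) x,
    v =1 t \o u -> act hv x = act hu (act ht x)
}.

Lemma lift_mono p (i : 'I_p.+2) : @mono p.+1 p (fintype.lift i).
Proof. by move=> j k; rewrite /= leq_bump2. Qed.

Lemma bump_bump i j k : (i <= j)%N ->
  bump j.+1 (bump i k) = bump i (bump j k).
Proof.
rewrite /bump => ij; case: (leqP j k) => jk.
  by rewrite (leq_trans ij jk) !add1n ltnS jk leqW // (leq_trans ij jk).
rewrite add0n; case: (leqP i k) => ik; first by rewrite add1n ltnS leqNgt jk.
by rewrite !add0n ltnNge (ltnW jk).
Qed.

Section Underlying.
Variables (R : pzRingType) (X : simplicial R).

Lemma underlying_fac_fac p (i j : 'I_p.+2) (i' j' : 'I_p.+3)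
    (x : slev X p.+2) :
  val i' = val i -> val j' = (val j).+1 -> (i <= j)%N ->
  act X (lift_mono i) (act X (lift_mono j') x) =
  act X (lift_mono j) (act X (lift_mono i') x).
Proof.
move=> ii jj ij.
have hv : @mono p.+2 p (fintype.lift j' \o fintype.lift i).
  by move=> k l kl; apply/lift_mono/lift_mono.
rewrite -(act_cmp (v := fintype.lift j' \o fintype.lift i) _ _ hv) //.
apply: act_cmp => k; apply: val_inj => /=.
by rewrite ii jj; apply: bump_bump.
Qed.

(* the i-th face is the action of the injection [p] -> [p+1] that omits i *)
Definition underlying : preSimplicial R :=
  @PreSimplicial R (slev X) (fun p i => act X (lift_mono i)) underlying_fac_fac.
End Underlying.
Coercion underlying : simplicial >-> preSimplicial.

Section Nerve.
Variables (R : comNzRingType) (C : smallCat) (F : modFunctor R C).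

Record chain p := Chain {
  cob : 'I_p.+1 -> ob C;
  cmor : forall i j : 'I_p.+1, val j = (val i).+1 -> hom C (cob i) (cob j)
}.

(* the sequences lambda_0, ..., lambda_p with lambda_(j+1) = g_j (lambda_j) *)
Definition coherent p (c : chain p) (l : forall i, fob F (cob c i)) : Prop :=
  forall i j (ij : val j = (val i).+1), fmap F (cmor c ij) (l i) = l j.

Definition melt := {A : ob C & fob F A}.

Definition seq_of p (c : chain p) (l : forall i, fob F (cob c i)) :
  'I_p.+1 -> melt := fun i => existT _ (cob c i) (l i).

Definition is_simplex p (s : 'I_p.+1 -> melt) : Prop :=
  exists (c : chain p) (l : forall i, fob F (cob c i)),
    coherent l /\ s = seq_of l.

Definition simplex p : choiceType :=
  {classic {s : 'I_p.+1 -> melt | is_simplex s}}.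

Definition mk_simplex p (c : chain p) (l : forall i, fob F (cob c i))
    (h : coherent l) : simplex p :=
  exist _ (seq_of l) (ex_intro _ c (ex_intro _ l (conj h erefl))).

Lemma coherent_linear p (c : chain p) a (l m : forall i, fob F (cob c i)) :
  coherent l -> coherent m -> coherent (fun i => a *: l i + m i).
Proof. by move=> hl hm i j ij; rewrite linearP hl hm. Qed.

Lemma chain_mor p (c : chain p) (i j : 'I_p.+1) : (i <= j)%N ->
  {g : hom C (cob c i) (cob c j) |
    forall l : forall i, fob F (cob c i), coherent l -> fmap F g (l i) = l j}.
Proof.
case: j => j; elim: j => [|j IH] hj ij.
  have -> : i = Ordinal hj by apply: val_inj => /=; apply/eqP; rewrite -leqn0.
  by exists (idm C _) => l _; apply: fmap_id.
have [e|ne] := eqVneq i (Ordinal hj).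
  by case: _ / e; exists (idm C _) => l _; apply: fmap_id.
have ij' : (i <= j)%N.
  by move: ij; rewrite leq_eqVlt => /orP[/eqP e|//];
     case/eqP: ne; apply: val_inj.
have [g hg] := IH (ltnW hj) ij'.
have e : val (Ordinal hj) = (val (Ordinal (ltnW hj))).+1 by [].
by exists (cmp g (cmor c e)) => l hl; rewrite fmap_cmp hg // hl.
Qed.

Lemma succ_leq p (i j : 'I_p.+1) : val j = (val i).+1 -> (i <= j)%N.
Proof. by move=> /= ->. Qed.

Definition restr_chain p q (t : 'I_q.+1 -> 'I_p.+1) (h : mono t)
    (c : chain p) : chain q :=
  @Chain q (fun i => cob c (t i))
    (fun i j ij => sval (chain_mor c (h i j (succ_leq ij)))).

Lemma restr_coherent p q (t : 'I_q.+1 -> 'I_p.+1) (h : mono t) (c : chain p)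
    (l : forall i, fob F (cob c i)) :
  coherent l -> @coherent q (restr_chain h c) (fun i => l (t i)).
Proof. by move=> hl i j ij; apply: (svalP (chain_mor c _)). Qed.

Lemma restr_simplex p q (t : 'I_q.+1 -> 'I_p.+1) (h : mono t)
    (s : 'I_p.+1 -> melt) : is_simplex s -> is_simplex (s \o t).
Proof.
move=> [c [l [hl ->]]]; exists (restr_chain h c), (fun i => l (t i)).
by split=> //; apply: restr_coherent.
Qed.

(* For t the injection that omits j this deletes lambda_j, and for t the
   surjection that repeats j it repeats lambda_j. *)
Definition restr p q (t : 'I_q.+1 -> 'I_p.+1) (h : mono t) (s : simplex p) :
    simplex q :=
  exist _ (sval s \o t) (restr_simplex h (svalP s)).

(* <a l + m; g> = a <l; g> + <m; g> for symbols over the same morphisms.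
   A symbol <lambda; g> stands for an element lambda of the module F(A_0), so
   the module generated by the symbols is linear in lambda: each chain of
   morphisms contributes a copy of F(A_0), as in the usual complex computing
   the homology of C with coefficients in F.  On the free module on the bare
   set of symbols, H_0 of a point would be the free module on the set F(A_0)
   instead of F(A_0). *)
Definition additive_rel p (z : {freeg (simplex p) / R}) : Prop :=
  exists (c : chain p) (a : R) (l m : forall i, fob F (cob c i))
         (hl : coherent l) (hm : coherent m),
    z = << mk_simplex (coherent_linear a hl hm) >>
        - (a *: << mk_simplex hl >> + << mk_simplex hm >>).

Definition nerve_lev p : lmodType R := quot (@additive_rel p).

Definition nerve_map p q (t : 'I_q.+1 -> 'I_p.+1) (h : mono t) :
    {linear {freeg (simplex p) / R} -> {freeg (simplex q) / R}} :=
  flift (fun s => << restr h s >>).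

Lemma simplex_eq p (s s' : simplex p) : sval s =1 sval s' -> s = s'.
Proof.
case: s s' => [s hs] [s' hs'] /= /funext e; move: hs hs'; rewrite e => hs hs'.
by congr exist; apply: Prop_irrelevance.
Qed.

Lemma nerve_map_gen p q (t : 'I_q.+1 -> 'I_p.+1) (h : mono t) s :
  nerve_map h << s >> = << restr h s >>.
Proof. exact: fglift_gen. Qed.

Lemma nerve_map_rel p q (t : 'I_q.+1 -> 'I_p.+1) (h : mono t) z :
  additive_rel z -> span (@additive_rel q) (nerve_map h z).
Proof.
move=> [c [a [l [m [hl [hm ->]]]]]]; apply: span_gen.
exists (restr_chain h c), a, (fun i => l (t i)), (fun i => m (t i)).
exists (restr_coherent h hl), (restr_coherent h hm).
rewrite linearB linearD linearZ !nerve_map_gen.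
by congr (<< _ >> - (_ *: << _ >> + << _ >>)); apply: simplex_eq.
Qed.

Definition nerve_act p q (t : 'I_q.+1 -> 'I_p.+1) (h : mono t) :
    {linear nerve_lev p -> nerve_lev q} :=
  quot_map (nerve_map_rel h).

Lemma nerve_act_id p (t : 'I_p.+1 -> 'I_p.+1) (h : mono t) x :
  t =1 id -> nerve_act h x = x.
Proof.
move=> e; elim/quot_ind: x => x; rewrite [LHS](quot_map_funE (nerve_map_rel h)).
congr (proj _ _).
elim/free_ind: x => [|a s z IH]; first exact: linear0.
rewrite linearP IH nerve_map_gen; congr (_ *: << _ >> + _).
by apply: simplex_eq => i /=; rewrite e.
Qed.

Lemma nerve_act_cmp p q r (t : 'I_q.+1 -> 'I_p.+1) (u : 'I_r.+1 -> 'I_q.+1)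
    (v : 'I_r.+1 -> 'I_p.+1) (ht : mono t) (hu : mono u) (hv : mono v) x :
  v =1 t \o u -> nerve_act hv x = nerve_act hu (nerve_act ht x).
Proof.
move=> e; elim/quot_ind: x => x; rewrite [LHS](quot_map_funE (nerve_map_rel hv)).
rewrite [nerve_act ht _](quot_map_funE (nerve_map_rel ht)).
rewrite [RHS](quot_map_funE (nerve_map_rel hu)).
congr (proj _ _); elim/free_ind: x => [|a s z IH]; first by rewrite !linear0.
rewrite !linearP IH !nerve_map_gen; congr (_ *: << _ >> + _).
by apply: simplex_eq => i /=; rewrite e.
Qed.

Definition Fnerve : simplicial R := Simplicial nerve_act_id nerve_act_cmp.

Definition cat_homology p : lmodType R := homology Fnerve p.
End Nerve.

Section DirectSum.
Variables (R : pzRingType) (I : eqType) (M : I -> lmodType R).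

Definition dfun := forall i, M i.
HB.instance Definition _ := Choice.on dfun.

Definition dfun_add (x y : dfun) : dfun := fun i => x i + y i.
Definition dfun_opp (x : dfun) : dfun := fun i => - x i.
Definition dfun_zero : dfun := fun i => 0.
Definition dfun_scale a (x : dfun) : dfun := fun i => a *: x i.

Lemma dfun_addA : associative dfun_add.
Proof. by move=> x y z; apply/functional_extensionality_dep=> i; apply: addrA. Qed.
Lemma dfun_addC : commutative dfun_add.
Proof. by move=> x y; apply/functional_extensionality_dep=> i; apply: addrC. Qed.
Lemma dfun_add0 : left_id dfun_zero dfun_add.
Proof. by move=> x; apply/functional_extensionality_dep=> i; apply: add0r. Qed.
Lemma dfun_addN : left_inverse dfun_zero dfun_opp dfun_add.
Proof. by move=> x; apply/functional_extensionality_dep=> i; apply: addNr. Qed.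
HB.instance Definition _ :=
  GRing.isZmodule.Build dfun dfun_addA dfun_addC dfun_add0 dfun_addN.

Lemma dfun_scaleA a b v : dfun_scale a (dfun_scale b v) = dfun_scale (a * b) v.
Proof. by apply/functional_extensionality_dep=> i; apply: scalerA. Qed.
Lemma dfun_scale1 : left_id 1 dfun_scale.
Proof. by move=> x; apply/functional_extensionality_dep=> i; apply: scale1r. Qed.
Lemma dfun_scaleDr : right_distributive dfun_scale +%R.
Proof.
by move=> a x y; apply/functional_extensionality_dep=> i; apply: scalerDr.
Qed.
Lemma dfun_scaleDl v : {morph dfun_scale^~ v : a b / a + b}.
Proof.
by move=> a b; apply/functional_extensionality_dep=> i; apply: scalerDl.
Qed.
HB.instance Definition _ := GRing.Zmodule_isLmodule.Build R dfun
  dfun_scaleA dfun_scale1 dfun_scaleDr dfun_scaleDl.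

(* the direct sum of the M i, for a finite index type I *)
Definition dsum : lmodType R := dfun.

Definition dinj i (y : M i) : dsum :=
  fun j => if i =P j is ReflectT e then eq_rect i M y j e else 0.

Lemma dinj_linear i : linear (@dinj i).
Proof.
move=> a x y; apply/functional_extensionality_dep=> j.
rewrite -[RHS]/(a *: dinj x j + dinj y j) /dinj.
by case: eqP => [e|_]; [case: _ / e | rewrite scaler0 addr0].
Qed.
HB.instance Definition _ i :=
  GRing.isLinear.Build R (M i) dsum *:%R (@dinj i) (@dinj_linear i).

End DirectSum.

Section Nabla.
Variables (R : comNzRingType) (n : nat) (F : modFunctor R (cube n)).

Definition kword k : finType := {v : word n | nA v == k}.

(* the position of the i-th letter A of v, counting from 0 *)
Definition ithA k (v : kword k.+1) (i : 'I_k.+1) : 'I_n :=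
  @enum_val _ [set j | val v j] (cast_ord (esym (eqP (valP v))) i).

Lemma eraseA_le (v : word n) c : wle v (eraseA v c).
Proof. by apply/forallP=> j; rewrite ffunE; case: eqP => /= *; rewrite ?implybb. Qed.

Lemma eraseA_set (v : word n) c :
  [set j | eraseA v c j] = [set j | v j] :\ c.
Proof. by apply/setP=> j; rewrite !inE ffunE; case: eqP. Qed.

Lemma erase_proof k (v : kword k.+1) i : nA (eraseA (val v) (ithA v i)) == k.
Proof.
have := valP v; rewrite /nA (cardsD1 (ithA v i)) enum_valP add1n eqSS.
by rewrite eraseA_set.
Qed.

Definition erase k (v : kword k.+1) (i : 'I_k.+1) : kword k :=
  exist _ (eraseA (val v) (ithA v i)) (erase_proof v i).

Definition summand k (v : kword k) : lmodType R := fob F (val v).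

Definition erase_map k (v : kword k.+1) (i : 'I_k.+1) :
    {linear summand v -> summand (erase v i)} :=
  fmap F (eraseA_le (val v) (ithA v i) : hom (cube n) _ _).

Definition nabla_lev k : lmodType R := dsum (@summand k).

Definition erase_face k (i : 'I_k.+1) (x : nabla_lev k.+1) : nabla_lev k :=
  \sum_(v : kword k.+1) dinj (M := @summand k) (erase_map v i (x v)).

Lemma erase_face_linear k i : linear (@erase_face k i).
Proof.
move=> a x y; rewrite /erase_face scaler_sumr -big_split.
by apply: eq_bigr => v _ /=; rewrite -linearP -linearP.
Qed.
HB.instance Definition _ k i :=
  GRing.isLinear.Build R (nabla_lev k.+1) (nabla_lev k) *:%R
    (@erase_face k i) (@erase_face_linear k i).

Definition nabla_fac k (i : 'I_k.+2) : {linear nabla_lev k.+1 -> nabla_lev k} :=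
  if unlift ord0 i is Some i' then @erase_face k i' else \0.

Lemma dinj_same k (v : kword k) (y : summand v) : dinj y v = y.
Proof. by rewrite /dinj; case: eqP => // e; rewrite (eq_axiomK e). Qed.

Lemma dinj_other k (v w : kword k) (y : summand v) : w != v -> dinj y w = 0.
Proof. by rewrite /dinj; case: eqP => // e /eqP[]. Qed.

Lemma erase_dinj k (i : 'I_k.+1) (v : kword k.+1) (y : summand v) :
  erase_face i (dinj y : nabla_lev k.+1) = dinj (erase_map v i y).
Proof.
rewrite /erase_face (bigD1 v) //= big1 ?addr0 => [|w wv]; first by rewrite dinj_same.
by rewrite dinj_other // !linear0.
Qed.

Lemma nabla_sum k (x : nabla_lev k) : x = \sum_(v : kword k) dinj (x v).
Proof.
have eval (J : Type) (r : seq J) (f : J -> nabla_lev k) w :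
    (\sum_(v <- r) f v) w = \sum_(v <- r) f v w.
  by elim: r => [|v r IH]; rewrite ?big_nil // !big_cons -IH.
apply/functional_extensionality_dep=> w; rewrite eval (bigD1 w) //= dinj_same.
by rewrite big1 ?addr0 // => v vw; rewrite dinj_other // eq_sym.
Qed.

Lemma dinj_eq k (u : word n) (v w : kword k) (hv : wle u (val v))
    (hw : wle u (val w)) (y : fob F u) : v = w ->
  dinj (M := @summand k) (fmap F (hv : hom (cube n) _ _) y : summand v) =
  dinj (M := @summand k) (fmap F (hw : hom (cube n) _ _) y : summand w).
Proof.
by move=> e; case: _ / e hw => hw; rewrite (bool_irrelevance hv hw).
Qed.

Lemma ithA_nth k (v : kword k.+1) (i : 'I_k.+1) x0 :
  ithA v i = nth x0 (enum [set j | val v j]) i.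
Proof. by rewrite /ithA (enum_val_nth x0). Qed.

Lemma enum_erase k (v : kword k.+1) (i : 'I_k.+1) :
  enum [set j | val (erase v i) j] = rem (ithA v i) (enum [set j | val v j]).
Proof.
rewrite rem_filter ?enum_uniq // /= eraseA_set /enum_mem -filter_predI.
by apply: eq_filter => j; rewrite !inE.
Qed.

Lemma nth_rem (T : eqType) (x0 : T) (s : seq T) i j :
  uniq s -> (i < size s)%N -> nth x0 (rem (nth x0 s i) s) j = nth x0 s (bump i j).
Proof.
elim: s i j => [|a s IH] [|i] j //= /andP[as_ us] si; first by rewrite eqxx.
have -> : (a == nth x0 s i) = false.
  by apply: contraNF as_ => /eqP ->; apply: mem_nth.
case: j => [|j] /=; first by rewrite /bump.
by rewrite IH // bumpS.
Qed.

Lemma ithA_erase k (v : kword k.+2) (i : 'I_k.+2) (j : 'I_k.+1) (l : 'I_k.+2) :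
  val l = bump i j -> ithA (erase v i) j = ithA v l.
Proof.
move=> lij; set x0 := ithA v i.
have si : (i < size (enum [set j | val v j]))%N.
  by rewrite -cardE; have /eqP := valP v; rewrite /nA => ->.
by rewrite !(ithA_nth _ _ x0) enum_erase (ithA_nth _ _ x0) nth_rem ?enum_uniq // lij.
Qed.

Lemma erase_erase k (i j : 'I_k.+1) (i' j' : 'I_k.+2) (v : kword k.+2) :
  val i' = val i -> val j' = (val j).+1 -> (i <= j)%N ->
  erase (erase v j') i = erase (erase v i') j.
Proof.
move=> ii jj ij; apply: val_inj; apply/ffunP=> c; rewrite /= !ffunE.
rewrite (@ithA_erase _ v j' i i') ?ii ?jj; last first.
  by rewrite /bump ltnNge ij.
rewrite (@ithA_erase _ v i' j j') ?ii ?jj; last by rewrite /bump ij.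
by case: (c == ithA v i'); case: (c == ithA v j').
Qed.

Lemma erase_face_comm k (i j : 'I_k.+1) (i' j' : 'I_k.+2) x :
  val i' = val i -> val j' = (val j).+1 -> (i <= j)%N ->
  erase_face i (erase_face j' x) = erase_face j (erase_face i' x).
Proof.
move=> ii jj ij; rewrite (nabla_sum x) !linear_sum; apply: eq_bigr => v _.
rewrite /= !erase_dinj /erase_map -!fmap_cmp; apply: dinj_eq.
exact: erase_erase.
Qed.

Lemma nabla_fac_fac k (i j : 'I_k.+2) (i' j' : 'I_k.+3) x :
  val i' = val i -> val j' = (val j).+1 -> (i <= j)%N ->
  nabla_fac i (nabla_fac j' x) = nabla_fac j (nabla_fac i' x).
Proof.
move=> ii jj ij; rewrite /nabla_fac.
case: (unliftP ord0 i') => [i'1|] ei'; case: (unliftP ord0 i) => [i1|] ei;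
  case: (unliftP ord0 j') => [j'1|] ej'; case: (unliftP ord0 j) => [j1|] ej;
  rewrite /= ?linear0 //; move: ii jj ij; rewrite ei ei' ej ej' /= /bump /= ?add1n //.
by move=> [ii] [jj]; rewrite ltnS => ij; apply: erase_face_comm.
Qed.

Definition Fnabla : preSimplicial R := PreSimplicial nabla_fac_fac.
End Nabla.

Definition KhoH (R : comNzRingType) (V : comAlgType R) (fr : frobenius V)
    (n : nat) (K : diagram n) (F : stateFunctor fr K) (k : nat) : lmodType R :=
  homology (Fnabla F) k.

(* Main.v *)
(* Both homologies are those of a complex of direct sums of modules F (base x),
   where x runs over "generators" that do not depend on F: the faces of the
   simplex for [Fnabla], the descending chains of faces (with base the first
   term) for [Fnerve].  The boundaries come from contravariant complexes of free
   functors on the poset of faces, whose values at a face s are the simplicial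
   chains of s and the nerve chains of the poset of faces of s.  Both are
   acyclic: coning with the least vertex of s contracts the former, coning with
   s itself the latter.  By acyclic models the two free complexes are naturally
   chain homotopy equivalent, and a natural map between them induces a map with
   coefficients in any F.  The faces of the simplex that miss the vertex 0 do
   not contribute to [Fnabla], because the extension of F vanishes there. *)
Require Import Defs.
From mathcomp Require Import all_boot all_algebra.
From HB Require Import structures.
From mathcomp Require Import all_order boolp freeg.
(* [span] and [hom] of Defs are shadowed by those of MathComp's vector. *)
Import Defs.
Set Implicit Arguments.
Unset Strict Implicit.
Unset Printing Implicit Defensive.
Import GRing.Theory.
Local Open Scope ring_scope.

(** * Chain maps and homology *)

Section HomologyMap.
Variables (R : pzRingType) (A B : preSimplicial R).
Variable f : forall p, {linear lev A p -> lev B p}.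
Hypothesis f_bd : forall p x, f p (bd x) = bd (f p.+1 x).

Lemma chain_map_cycle p (z : cycles A p) : f p (cyc z) \in @is_cycle R B p.
Proof.
case: p z => [|p] // z; have := cycP z; rewrite !inE /= => /eqP z0.
by rewrite -f_bd z0 linear0.
Qed.

Definition cycles_map_fun p (z : cycles A p) : cycles B p :=
  Cycle (chain_map_cycle z).

Lemma cycles_map_linear p : linear (@cycles_map_fun p).
Proof. by move=> a x y; apply: val_inj; rewrite /= !linearP. Qed.
HB.instance Definition _ p :=
  GRing.isLinear.Build R (cycles A p) (cycles B p) *:%R
    (@cycles_map_fun p) (@cycles_map_linear p).

Lemma cycles_map_boundary p (z : cycles A p) :
  is_boundary z -> span (@is_boundary R B p) (cycles_map_fun z).
Proof.
by move=> [y zy]; apply: span_gen; exists (f p.+1 y); rewrite /= zy f_bd.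
Qed.

Definition homology_map p : {linear homology A p -> homology B p} :=
  quot_map (@cycles_map_boundary p).

Lemma homology_map_proj p (z : cycles A p) :
  homology_map p (proj _ z) = proj _ (cycles_map_fun z).
Proof. exact: (quot_map_funE (@cycles_map_boundary p)). Qed.
End HomologyMap.

(** The hypothesis concerns cycles only, where the term h(dx) of a chain homotopy vanishes; this
    form also covers degree 0, in which there is no such term. *)
Lemma homology_map_cancel (R : pzRingType) (A B : preSimplicial R)
    (f : forall p, {linear lev A p -> lev B p})
    (g : forall p, {linear lev B p -> lev A p})
    (f_bd : forall p x, f p (bd x) = bd (f p.+1 x))
    (g_bd : forall p x, g p (bd x) = bd (g p.+1 x)) p :
  (forall x, x \in @is_cycle R A p -> exists y, g p (f p x) - x = bd y) ->
  cancel (homology_map f_bd p) (homology_map g_bd p).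
Proof.
move=> gf; elim/quot_ind=> z; rewrite !homology_map_proj.
apply/projP/span_gen; have [y zy] := gf _ (cycP z).
by exists y; rewrite -zy.
Qed.

Lemma homology_iso (R : pzRingType) (A B : preSimplicial R)
    (f : forall p, {linear lev A p -> lev B p})
    (g : forall p, {linear lev B p -> lev A p})
    (f_bd : forall p x, f p (bd x) = bd (f p.+1 x))
    (g_bd : forall p x, g p (bd x) = bd (g p.+1 x)) p :
  (forall x, x \in @is_cycle R A p -> exists y, g p (f p x) - x = bd y) ->
  (forall x, x \in @is_cycle R B p -> exists y, f p (g p x) - x = bd y) ->
  lmod_iso (homology A p) (homology B p).
Proof.
move=> gf fg; exists (homology_map f_bd p), (homology_map g_bd p).
- exact: homology_map_cancel.
- exact: homology_map_cancel.
Qed.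

(** * Free modules on finite sets *)

Section LinearExtension.
Variables (R : comNzRingType) (X : finType).
Notation vec X := {ffun X -> R^o}.

Definition unitv (x : X) : vec X := [ffun y => (x == y)%:R].

Definition lext (W : lmodType R) (t : X -> W) (z : vec X) : W :=
  \sum_x z x *: t x.

Lemma lext_linear (W : lmodType R) (t : X -> W) : linear (lext t).
Proof.
move=> a z w; rewrite /lext scaler_sumr -big_split; apply: eq_bigr => x _ /=.
by rewrite !ffunE scalerDl scalerA.
Qed.
HB.instance Definition _ (W : lmodType R) (t : X -> W) :=
  GRing.isLinear.Build R (vec X) W *:%R (lext t) (lext_linear t).

Lemma lext_unitv (W : lmodType R) (t : X -> W) x : lext t (unitv x) = t x.
Proof.
rewrite /lext (bigD1 x) //= ffunE eqxx scale1r big1 ?addr0 // => y yx.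
by rewrite ffunE eq_sym (negbTE yx) scale0r.
Qed.

Lemma lext_id (z : vec X) : lext unitv z = z.
Proof.
apply/ffunP=> y; rewrite sum_ffunE (bigD1 y) //= !ffunE eqxx.
rewrite [_ *: _]mulr1 big1 ?addr0 // => x xy.
by rewrite !ffunE (negbTE xy) [_ *: _]mulr0.
Qed.

Lemma linear_lext (W W' : lmodType R) (f : {linear W -> W'}) (t : X -> W) z :
  f (lext t z) = lext (fun x => f (t x)) z.
Proof. by rewrite linear_sum; apply: eq_bigr => x _; rewrite linearZ. Qed.

Lemma eq_lext (W : lmodType R) (t t' : X -> W) (z : vec X) :
  (forall x, z x != 0 -> t x = t' x) -> lext t z = lext t' z.
Proof.
move=> e; apply: eq_bigr => x _.
by have [->|/e ->//] := eqVneq (z x) 0; rewrite !scale0r.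
Qed.

Lemma lextB (W : lmodType R) (t t' : X -> W) (z : vec X) :
  lext (fun x => t x - t' x) z = lext t z - lext t' z.
Proof. by rewrite -sumrB; apply: eq_bigr => x _; rewrite scalerBr. Qed.

End LinearExtension.
Arguments unitv R {X} x.

(** * Acyclic models over a poset *)

Section BasedComplexes.
Variables (R : comNzRingType) (T : Type) (le : T -> T -> bool).
Hypotheses (le_refl : forall a, le a a)
           (le_tr : forall a b c, le a b -> le b c -> le a c).
Notation vec X := {ffun X -> R^o}.

(* A contravariant complex of free functors on the poset, where [le a b] is
   the existence of a morphism a -> b: a generator [x] of degree p gives a
   copy of the functor represented by [base x], and the value of the complex at
   [s] is spanned by the generators x with [le s (base x)].  Only the elements
   of [gen p] that satisfy [ok] count as generators. *)
Record based := Based {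
  gen : nat -> finType;
  ok : forall p, pred (gen p);
  base : forall p, gen p -> T;
  dd : forall p, gen p.+1 -> vec (gen p)
}.
Arguments ok : clear implicits.
Arguments ok {b p} x.

(** Membership of [z] in the value of the complex at [s]. *)
Definition supp (X : based) p (s : T) (z : vec (gen X p)) : Prop :=
  forall x, z x != 0 -> ok x && le s (base x).

Definition bdv (X : based) p : {linear vec (gen X p.+1) -> vec (gen X p)} :=
  lext (@dd X p).

Definition aug (X : based) : {linear vec (gen X 0) -> R^o} :=
  lext (fun=> 1 : R^o).

(** In degree 0 the augmentation serves as boundary, so that acyclicity means having the homology of
    a point. *)
Definition cyclev (X : based) p : vec (gen X p) -> Prop :=
  match p with
  | 0 => fun z => aug X z = 0
  | p'.+1 => fun z => bdv X p' z = 0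
  end.

Record acyclic (X : based) : Prop := Acyclic {
  dd_supp : forall p (x : gen X p.+1), ok x -> supp (base x) (dd x);
  dd_cycle : forall p (x : gen X p.+1), ok x -> cyclev (dd x);
  point_ex : forall s, exists2 z, supp s z & aug X z = 1;
  fill_ex : forall p s (z : vec (gen X p)), supp s z -> cyclev z ->
    exists2 w, supp s w & bdv X p w = z
}.

Section Supports.
Variable X : based.

Lemma supp0 p s : supp s (0 : vec (gen X p)).
Proof. by move=> x; rewrite ffunE eqxx. Qed.

Lemma suppD p s (z w : vec (gen X p)) : supp s z -> supp s w -> supp s (z + w).
Proof.
move=> hz hw x; rewrite ffunE.
have [z0|/hz //] := eqVneq (z x) 0; rewrite z0 add0r; exact: hw.
Qed.

Lemma suppZ p s a (z : vec (gen X p)) : supp s z -> supp s (a *: z).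
Proof.
move=> hz x; rewrite ffunE => azx; apply: hz; apply: contraNneq azx => ->.
by rewrite scaler0.
Qed.

Lemma suppB p s (z w : vec (gen X p)) : supp s z -> supp s w -> supp s (z - w).
Proof. by move=> hz hw; rewrite -scaleN1r; apply/suppD/suppZ. Qed.

Lemma supp_sum (I : Type) (r : seq I) (P : pred I) p s (t : I -> vec (gen X p)) :
  (forall i, P i -> supp s (t i)) -> supp s (\sum_(i <- r | P i) t i).
Proof. by move=> h; elim/big_ind: _ => //; [apply: supp0 | apply: suppD]. Qed.

Lemma supp_lext (Y : finType) p s (t : Y -> vec (gen X p)) (z : vec Y) :
  (forall y, z y != 0 -> supp s (t y)) -> supp s (lext t z).
Proof.
move=> h; apply: supp_sum => y _.
have [->|/h] := eqVneq (z y) 0; last exact: suppZ.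
by rewrite scale0r; apply: supp0.
Qed.

Lemma supp_le p s s' (z : vec (gen X p)) : le s s' -> supp s' z -> supp s z.
Proof. by move=> ss hz x /hz/andP[-> ]; apply: le_tr. Qed.

Lemma supp_unitv p (x : gen X p) : ok x -> supp (base x) (unitv R x).
Proof.
move=> xok y; rewrite ffunE; have [<- _|_] := eqVneq x y.
  by rewrite xok le_refl.
by rewrite eqxx.
Qed.
End Supports.

(** By Yoneda, a natural map out of a free functor amounts to a choice, for each generator [x], of
    an element of the target's value at [base x]. *)
Definition natural (X Y : based) p q (t : gen X p -> vec (gen Y q)) : Prop :=
  forall x, ok x -> supp (base x) (t x).

Lemma supp_natural (X Y : based) p q (t : gen X p -> vec (gen Y q)) s z :
  natural t -> supp s z -> supp s (lext t z).
Proof.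
by move=> tn zs; apply: supp_lext => x /zs/andP[/tn h] /supp_le; apply.
Qed.

Record chainmap (X Y : based) (f : forall p, gen X p -> vec (gen Y p)) : Prop :=
  Chainmap {
    cm_natural : forall p, natural (f p);
    cm_aug : forall x, ok x -> aug Y (f 0 x) = 1;
    cm_bd : forall p (x : gen X p.+1), ok x ->
      bdv Y p (f p.+1 x) = lext (f p) (dd x)
  }.

Record homotopic (X Y : based) (f g : forall p, gen X p -> vec (gen Y p)) : Prop
  := Homotopic {
    homotopy : forall p, gen X p -> vec (gen Y p.+1);
    ho_natural : forall p, natural (@homotopy p);
    ho_0 : forall x, ok x -> bdv Y 0 (homotopy x) = f 0 x - g 0 x;
    ho_bd : forall p (x : gen X p.+1), ok x ->
      bdv Y p.+1 (homotopy x) + lext (@homotopy p) (dd x) = f p.+1 x - g p.+1 x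
  }.

(** On the value at [s], [cone s] is a chain homotopy between the identity and the augmentation
    followed by [apex s]. *)
Record contraction (X : based) : Type := Contraction {
  apex : T -> vec (gen X 0);
  cone : T -> forall p, gen X p -> vec (gen X p.+1);
  con_dd_supp : forall p (x : gen X p.+1), ok x -> supp (base x) (dd x);
  apex_supp : forall s, supp s (apex s);
  apex_aug : forall s, aug X (apex s) = 1;
  cone_supp : forall s p (x : gen X p), ok x -> le s (base x) ->
    supp s (cone s x);
  cone_0 : forall s (x : gen X 0), ok x -> le s (base x) ->
    bdv X 0 (cone s x) = unitv R x - apex s;
  cone_S : forall s p (x : gen X p.+1), ok x -> le s (base x) ->
    bdv X p.+1 (cone s x) = unitv R x - lext (@cone s p) (dd x);
  cone_onto : forall p (x : gen X p.+1), ok x -> exists y : gen X p,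
    [/\ ok y, le (base x) (base y) & unitv R x = cone (base x) y]
}.

Section Contraction.
Variables (X : based) (C : contraction X).

Lemma bdv_cone_0 s (z : vec (gen X 0)) : supp s z ->
  bdv X 0 (lext (@cone X C s 0) z) = z - aug X z *: apex C s.
Proof.
move=> zs; rewrite (linear_lext (bdv X 0)).
rewrite (eq_lext (t' := fun x => unitv R x - apex C s)); last first.
  by move=> x /zs/andP[]; apply: cone_0.
rewrite lextB lext_id; congr (_ - _); rewrite /aug /= /lext scaler_suml.
by apply: eq_bigr => x _; rewrite [_ *: 1]mulr1.
Qed.

Lemma bdv_cone_S s p (z : vec (gen X p.+1)) : supp s z ->
  bdv X p.+1 (lext (@cone X C s p.+1) z) =
  z - lext (@cone X C s p) (bdv X p z).
Proof.
move=> zs; rewrite (linear_lext (bdv X p.+1)).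
rewrite (eq_lext (t' := fun x => unitv R x - lext (@cone X C s p) (dd x))).
  by rewrite lextB lext_id [in RHS](linear_lext (lext _)).
by move=> x /zs/andP[]; apply: cone_S.
Qed.

(* Every generator is a cone over its own base, so that the contraction
   identity itself gives [dd \o dd = 0]. *)
Lemma contraction_cycle p (x : gen X p.+1) : ok x -> cyclev (dd x).
Proof.
elim: p x => [|p IH] x xok; have [y [yok xy xE]] := cone_onto C xok.
  rewrite -(lext_unitv (@dd X 0) x) xE [lext _ _]cone_0 //= linearB /=.
  by rewrite apex_aug /aug /= lext_unitv subrr.
rewrite -(lext_unitv (@dd X p.+1) x) xE [lext _ _]cone_S //=.
have ys : supp (base x) (dd y) by apply: supp_le xy (con_dd_supp C yok).
rewrite linearB /= [lext _ _]lext_unitv.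
move: {xE} (base x) xy ys => s sy ys {x xok}.
(* Here [dd x] is [y] minus the cone over [dd y]. As [dd y] is a cycle by induction, the boundary of
   its cone is [dd y] again, and the two terms cancel. *)
case: p IH y yok sy ys => [|p] IH y yok sy ys.
  by rewrite [lext _ (lext _ _)]bdv_cone_0 // (IH _ yok) scale0r subr0 subrr.
rewrite [lext _ (lext _ _)]bdv_cone_S // (IH _ yok).
by rewrite linear0 subr0 subrr.
Qed.

Lemma contraction_acyclic : acyclic X.
Proof.
split=> [||s|p s z zs zc]; first exact: con_dd_supp C.
- exact: contraction_cycle.
- by exists (apex C s); [apply: apex_supp | apply: apex_aug].
exists (lext (@cone X C s p) z).
  by apply: supp_lext => x /zs/andP[]; apply: cone_supp.
case: p z zs zc => [|p] z zs zc.
  by rewrite bdv_cone_0 // zc scale0r subr0.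
by rewrite bdv_cone_S // zc linear0 subr0.
Qed.
End Contraction.

(** * Existence of natural chain maps and their uniqueness up to homotopy *)

Section Models.
Variables X Y : based.
Hypotheses (aX : acyclic X) (aY : acyclic Y).

Definition point s : vec (gen Y 0) := sval (cid2 (point_ex aY s)).

Lemma pointP s : supp s (point s) /\ aug Y (point s) = 1.
Proof. by rewrite /point; case: cid2. Qed.

(** The default value 0 off the cycles over [s] makes this total, so that [model] can be defined by
    recursion before its values are known to be fillable. *)
Definition fill p s (z : vec (gen Y p)) : vec (gen Y p.+1) :=
  match pselect (supp s z), pselect (cyclev z) with
  | left hs, left hz => sval (cid2 (fill_ex aY hs hz))
  | _, _ => 0
  end.

Lemma fillP p s (z : vec (gen Y p)) : supp s z -> cyclev z ->
  supp s (fill s z) /\ bdv Y p (fill s z) = z.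
Proof.
by rewrite /fill; case: pselect => // hs _; case: pselect => // hz _; case: cid2.
Qed.

Fixpoint model p : gen X p -> vec (gen Y p) :=
  match p with
  | 0 => fun x => point (base x)
  | p'.+1 => fun x => fill (base x) (lext (@model p') (dd x))
  end.

(** The chain map equation is assumed only below degree [p], which is all that is known midway
    through the construction of [model]. *)
Lemma cyclev_lext (f : forall p, gen X p -> vec (gen Y p)) :
  (forall x, ok x -> aug Y (f 0 x) = 1) -> forall p,
  (forall q (x : gen X q.+1), (q < p)%N -> ok x ->
     bdv Y q (f q.+1 x) = lext (f q) (dd x)) ->
  forall s z, supp s z -> cyclev z -> cyclev (lext (f p) z).
Proof.
move=> f1 [|p] fb s z zs /= z0.
  rewrite linear_lext -[RHS]z0; apply: eq_lext => x /zs/andP[xok _].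
  exact: f1.
rewrite linear_lext (eq_lext (t' := fun x => lext (f p) (dd x))); last first.
  by move=> x /zs/andP[xok _]; apply: fb.
by rewrite -(linear_lext (lext (f p))) [lext _ z]z0 linear0.
Qed.

(** The induction carries the equations of all lower degrees: they make the image of [dd x] a cycle,
    which acyclicity of [Y] fills over [base x]. *)
Lemma model_step p :
  natural (@model p) /\
  (forall q (x : gen X q.+1), (q < p)%N -> ok x ->
     bdv Y q (model x) = lext (@model q) (dd x)).
Proof.
elim: p => [|p [nat_p bd_p]]; first by split=> // x _; apply: (pointP _).1.
have fil (x : gen X p.+1) : ok x ->
    supp (base x) (model x) /\ bdv Y p (model x) = lext (@model p) (dd x).
  move=> xok; apply: fillP.
    exact/(supp_natural nat_p)/(dd_supp aX).
  apply: (@cyclev_lext model _ p bd_p (base x)) => [y _||].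
  - exact: (pointP _).2.
  - exact: (dd_supp aX).
  - exact: (dd_cycle aX).
split=> [x /fil[] //|q x]; rewrite ltnS leq_eqVlt => /orP[/eqP eq|qp].
  by move: x; rewrite eq => x /fil[].
exact: bd_p.
Qed.

Lemma model_chainmap : chainmap model.
Proof.
split=> [p|x _|p x]; first exact: (model_step p).1.
  exact: (pointP _).2.
exact: (model_step p.+1).2.
Qed.

Section Homotopy.
Variables f g : forall p, gen X p -> vec (gen Y p).
Hypotheses (cf : chainmap f) (cg : chainmap g).

Fixpoint model_homotopy p : gen X p -> vec (gen Y p.+1) :=
  match p with
  | 0 => fun x => fill (base x) (f x - g x)
  | p'.+1 => fun x =>
      fill (base x) (f x - g x - lext (@model_homotopy p') (dd x))
  end.

(** What the homotopy has to bound: dh = f - g - hd prescribes dh once h is known one degree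
    lower. *)
Definition defect p : gen X p -> vec (gen Y p) :=
  match p with
  | 0 => fun x => f x - g x
  | p'.+1 => fun x => f x - g x - lext (@model_homotopy p') (dd x)
  end.

(** On [dd x] induction gives dh = f - g - hd, so that d(f - g - hd) = (f - g)d - (f - g - hd)d =
    hdd = 0. *)
Lemma defectP p (x : gen X p) : ok x ->
  supp (base x) (defect x) /\ cyclev (defect x).
Proof.
have fillh q (y : gen X q) : model_homotopy y = fill (base y) (defect y).
  by case: q y.
have fg q (y : gen X q) : ok y -> supp (base y) (f y - g y).
  by move=> yok; apply: suppB; apply: cm_natural.
elim: p x => [|p IH] x xok.
  split; first exact: fg.
  by rewrite /= linearB /= (cm_aug cf) // (cm_aug cg) // subrr.
have xs := dd_supp aX xok.
split.
  apply: suppB; first exact: fg.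
  by apply: supp_natural xs => y /IH[ys yc]; rewrite fillh; apply: (fillP _ _).1.
rewrite /= !linearB /= (cm_bd cf) // (cm_bd cg) // -lextB.
rewrite (linear_lext (lext (@dd Y p))).
rewrite (eq_lext (t := fun y => lext (@dd Y p) (model_homotopy y))
                 (t' := @defect p)); last first.
  move=> y /xs/andP[/IH[ys yc] _].
  by have := (fillP ys yc).2; rewrite -fillh.
case: p x xok {IH xs} => [|p] x xok /=. by rewrite subrr.
have -> : lext (fun y : gen X p.+1 =>
      f y - g y - lext (@model_homotopy p) (dd y)) (dd x) =
    lext (fun y => f y - g y) (dd x)
      - lext (fun y => lext (@model_homotopy p) (dd y)) (dd x).
  exact: lextB.
rewrite opprB addrCA subrr addr0 -linear_lext.
by have /= := dd_cycle aX xok; rewrite /bdv /= => ->; rewrite linear0.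
Qed.

Lemma model_homotopic : homotopic f g.
Proof.
have hP p (x : gen X p) : ok x -> supp (base x) (model_homotopy x) /\
    bdv Y p (model_homotopy x) = defect x.
  move=> /defectP[xs xc].
  have -> : model_homotopy x = fill (base x) (defect x) by case: p x {xs xc}.
  exact: fillP.
exists model_homotopy => [p x /hP[] //|x /hP[] //|p x /hP[_ -> /=]].
by rewrite subrK.
Qed.
End Homotopy.
End Models.

(** * Coefficients in a functor *)

Section Coefficients.
Variable F : modFunctor R (posetCat le_refl le_tr).

(** The value 0 in the absence of a morphism lets sums range over all generators. *)
Definition push (s t : T) : {linear fob F s -> fob F t} :=
  match @idP (le s t) with
  | ReflectT h => fmap F (h : hom (posetCat le_refl le_tr) s t)
  | ReflectF _ => \0
  end.

Lemma pushE s t (h : le s t) l :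
  push s t l = fmap F (h : hom (posetCat le_refl le_tr) s t) l.
Proof.
by rewrite /push; case: {-}_ / idP => // h'; rewrite (bool_irrelevance h h').
Qed.

Lemma push_id s l : push s s l = l.
Proof. by rewrite (pushE (le_refl s)) -[RHS](fmap_id F). Qed.

Lemma push_comp s t u l : le s t -> le t u -> push t u (push s t l) = push s u l.
Proof.
by move=> st tu; rewrite (pushE st) (pushE tu) (pushE (le_tr st tu)) -fmap_cmp.
Qed.

(** This presents [A] as the tensor product of [F] with the complex [X] over the poset: the functor
    represented by [base x] contributes a copy of [fob F (base x)]. *)
Record decomposition (X : based) (A : preSimplicial R) := Decomposition {
  ins : forall p (x : gen X p), {linear fob F (base x) -> lev A p};
  outs : forall p (x : gen X p), {linear lev A p -> fob F (base x)};
  ins_outs : forall p (a : lev A p),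
    \sum_(x : gen X p | ok x) ins x (outs x a) = a;
  outs_ins : forall p (x : gen X p) l, ok x -> outs x (ins x l) = l;
  outs_ins_neq : forall p (x y : gen X p) l,
    ok x -> ok y -> y != x -> outs y (ins x l) = 0;
  bd_ins : forall p (x : gen X p.+1) l, ok x ->
    bd (ins x l) = lext (fun y => ins y (push (base x) (base y) l)) (dd x)
}.

Section Spread.
Variables (X : based) (A : preSimplicial R) (D : decomposition X A).

(** The tensor of [l] and [z]; [spread_push] is the relation that moves a morphism across the tensor
    sign. *)
Definition spread p s (l : fob F s) (z : vec (gen X p)) : lev A p :=
  lext (fun y => ins D y (push s (base y) l)) z.

Lemma spread_linear p s (z : vec (gen X p)) : linear (fun l => spread (s:=s) l z).
Proof.
move=> a l m; rewrite /spread /lext scaler_sumr -big_split.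
apply: eq_bigr => x _ /=; by rewrite !linearP.
Qed.

Lemma spread_unitv p (x : gen X p) (l : fob F (base x)) :
  spread l (unitv R x) = ins D x l.
Proof. by rewrite /spread lext_unitv push_id. Qed.

Lemma spread_push p s t (l : fob F s) (z : vec (gen X p)) :
  le s t -> supp t z -> spread (push s t l) z = spread l z.
Proof.
by move=> st zt; apply: eq_lext => y /zt/andP[_ ty]; rewrite push_comp.
Qed.

Lemma ins_ind p (P : lev A p -> Prop) :
  P 0 -> (forall a b, P a -> P b -> P (a + b)) ->
  (forall x l, ok x -> P (ins D x l)) -> forall a, P a.
Proof.
move=> P0 PD Pi a; rewrite -(ins_outs D a); elim/big_ind: _ => // x xok.
exact: Pi.
Qed.

Lemma bd_spread p s (l : fob F s) (z : vec (gen X p.+1)) :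
  (forall q (x : gen X q.+1), ok x -> supp (base x) (dd x)) ->
  supp s z -> bd (spread l z) = spread l (bdv X p z).
Proof.
move=> Xs zs; rewrite [LHS](linear_lext (@bd R A p)) [RHS](linear_lext (lext _)).
apply: eq_lext => y /zs/andP[yok sy]; apply: etrans (bd_ins D _ yok) _.
exact: spread_push (Xs _ _ yok).
Qed.
End Spread.

Section Induced.
Variables (X Y : based) (A B : preSimplicial R).
Variables (DA : decomposition X A) (DB : decomposition Y B).

(** For natural [t], the tensor product of [t] with the identity of [F]. *)
Definition induced p q (t : gen X p -> vec (gen Y q)) (a : lev A p) : lev B q :=
  \sum_(x | ok x) spread DB (outs DA x a) (t x).

Lemma induced_linear p q (t : gen X p -> vec (gen Y q)) : linear (induced t).
Proof.
move=> a x y; rewrite /induced scaler_sumr -big_split; apply: eq_bigr => z _.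
by rewrite linearP spread_linear.
Qed.
HB.instance Definition _ p q (t : gen X p -> vec (gen Y q)) :=
  GRing.isLinear.Build R (lev A p) (lev B q) *:%R (induced t)
    (induced_linear t).

Lemma induced_ins p q (t : gen X p -> vec (gen Y q)) x l :
  ok x -> induced t (ins DA x l) = spread DB l (t x).
Proof.
move=> xok; rewrite /induced (bigD1 x) //= outs_ins // big1 ?addr0 //.
move=> y /andP[yok yx]; rewrite outs_ins_neq // /spread /lext big1 // => u _.
by rewrite !linear0.
Qed.

Lemma induced_spread p q (t : gen X p -> vec (gen Y q)) s (l : fob F s) z :
  natural t -> supp s z -> induced t (spread DA l z) = spread DB l (lext t z).
Proof.
move=> tn zs; rewrite [LHS](linear_lext (induced t)) [RHS](linear_lext (lext _)).
apply: eq_lext => y /zs/andP[yok sy]; apply: etrans (induced_ins _ _ yok) _.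
exact: spread_push (tn _ yok).
Qed.

End Induced.

Lemma bd_induced (X Y : based) (A B : preSimplicial R)
    (DA : decomposition X A) (DB : decomposition Y B) f :
  acyclic X -> acyclic Y -> @chainmap X Y f -> forall p a,
  induced DA DB (f p) (bd a) = bd (induced DA DB (f p.+1) a).
Proof.
move=> aX aY [f_nat _ f_bd] p a.
elim/(ins_ind (D := DA)): a => [|a b IHa IHb|x l xok].
- by rewrite !linear0.
- by rewrite !linearD /= IHa IHb.
rewrite bd_ins // [LHS]induced_spread //; last exact: (dd_supp aX).
rewrite induced_ins // bd_spread ?f_bd //; last exact: f_nat.
exact: (dd_supp aY).
Qed.

Lemma induced_homotopy (X Y : based) (A B : preSimplicial R)
    (DA : decomposition X A) (DB : decomposition Y B) f g :
  acyclic X -> acyclic Y ->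
  @chainmap X Y f -> @chainmap Y X g ->
  homotopic (fun p x => lext (g p) (f p x)) (fun p => unitv R) ->
  forall p a, a \in @is_cycle R A p -> exists b,
    induced DB DA (g p) (induced DA DB (f p) a) - a = bd b.
Proof.
move=> aX aY [f_nat _ _] [g_nat _ _] [h h_nat h0 hb] p a ac.
exists (induced DA DA (h p) a).
have Xs := dd_supp aX.
have gfE q (x : gen X q) l : ok x ->
    induced DB DA (g q) (induced DA DB (f q) (ins DA x l)) - ins DA x l =
    spread DA l (lext (g q) (f q x) - unitv R x).
  move=> xok; rewrite induced_ins // induced_spread //; last exact: f_nat.
  by rewrite -(spread_unitv DA l) /spread linearB.
case: p a ac => [|p] a.
  move=> _; elim/(ins_ind (D := DA)): a => [|a b IHa IHb|x l xok].
  - by rewrite !linear0 addr0.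
  - by rewrite !linearD /= -IHa -IHb addrACA.
  by rewrite gfE // -h0 // induced_ins // bd_spread //; apply: h_nat.
(* The relation gf - 1 = dh + hd holds on all chains of positive degree; its last term vanishes on
   the cycle [a]. *)
suff -> : induced DB DA (g p.+1) (induced DA DB (f p.+1) a) - a =
    bd (induced DA DA (h p.+1) a) + induced DA DA (h p) (bd a).
  by move=> /eqP ->; rewrite linear0 addr0.
elim/(ins_ind (D := DA)): a => [|a b IHa IHb|x l xok].
- by rewrite !linear0 !addr0.
- by rewrite !linearD /= [RHS]addrACA -IHa -IHb addrACA.
rewrite gfE // -hb // induced_ins // bd_spread //; last exact: h_nat.
rewrite bd_ins // [X in _ = _ + X]induced_spread //; last exact: Xs.
by rewrite /spread linearD.
Qed.

Lemma comp_chainmap (X Y Z : based) f g :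
  acyclic X -> @chainmap X Y f -> @chainmap Y Z g ->
  chainmap (fun p (x : gen X p) => lext (g p) (f p x)).
Proof.
move=> aX [f_nat f_aug f_bd] [g_nat g_aug g_bd]; split=> [p x xok|x xok|p x xok].
- exact: supp_natural (f_nat p x xok).
- rewrite (linear_lext (aug Z)) -[RHS](f_aug x xok); apply: eq_lext => y.
  by move=> /(f_nat _ _ xok)/andP[/g_aug].
rewrite (linear_lext (bdv Z p)) (eq_lext (t' := fun y => lext (g p) (dd y))).
  by rewrite -(linear_lext (lext (g p))) [lext _ (f _ _)]f_bd // linear_lext.
by move=> y /(f_nat _ _ xok)/andP[/g_bd].
Qed.

Lemma id_chainmap (X : based) : chainmap (fun p (x : gen X p) => unitv R x).
Proof.
split=> [p x xok|x _|p x _]; first exact: supp_unitv.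
- exact: lext_unitv.
- by rewrite [LHS]lext_unitv lext_id.
Qed.

(** [model] supplies natural chain maps both ways. Each composite and the identity are chain maps of
    one acyclic complex to itself, hence homotopic, and the homotopies survive tensoring with
    [F]. *)
Theorem acyclic_homology_iso (X Y : based) (A B : preSimplicial R) p :
  acyclic X -> acyclic Y -> decomposition X A -> decomposition Y B ->
  lmod_iso (homology A p) (homology B p).
Proof.
move=> aX aY DA DB; pose f := @model X Y aY; pose g := @model Y X aX.
have cf : chainmap f by apply: model_chainmap.
have cg : chainmap g by apply: model_chainmap.
apply: (homology_iso (f := fun p => induced DA DB (f p))
                     (g := fun p => induced DB DA (g p))) => [q x|q x|x|x].
- exact: bd_induced.
- exact: bd_induced.
- apply: induced_homotopy => //; apply: model_homotopic => //.
    exact: comp_chainmap.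
  exact: id_chainmap.
- apply: induced_homotopy => //; apply: model_homotopic => //.
    exact: comp_chainmap.
  exact: id_chainmap.
Qed.

End Coefficients.
End BasedComplexes.

(** * Linear maps out of a quotient *)

Section QuotientLift.
Variables (R : pzRingType) (M W : lmodType R) (S : M -> Prop).
Variable f : {linear M -> W}.
Hypothesis fS : forall x, S x -> f x = 0.

Definition quot_lift_fun (q : quot S) : W := f (rep q).

Lemma quot_lift_funE x : quot_lift_fun (proj S x) = f x.
Proof.
apply/eqP; rewrite -subr_eq0 -linearB; apply/eqP.
elim: (rep_proj S x) => [|a u v Su _ IH]; first exact: linear0.
by rewrite linearP IH fS // scaler0 addr0.
Qed.

Lemma quot_lift_linear : linear quot_lift_fun.
Proof.
move=> a; elim/quot_ind=> x; elim/quot_ind=> y.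
by rewrite -linearP !quot_lift_funE linearP.
Qed.
HB.instance Definition _ :=
  GRing.isLinear.Build R (quot S) W *:%R quot_lift_fun quot_lift_linear.
Definition quot_lift : {linear quot S -> W} := quot_lift_fun.
End QuotientLift.

(** * The nerve of a finite poset *)

Section NerveChains.
Variables (R : comNzRingType) (T : finType) (le : T -> T -> bool).
Hypotheses (le_refl : forall a, le a a)
           (le_tr : forall a b c, le a b -> le b c -> le a c).

Definition seqT p : finType := {ffun 'I_p.+1 -> T}.

Definition descending p : pred (seqT p) :=
  fun c => [forall i : 'I_p.+1, forall j : 'I_p.+1, (i <= j)%N ==> le (c i) (c j)].

Definition sface p (i : 'I_p.+2) (c : seqT p.+1) : seqT p :=
  [ffun j => c (fintype.lift i j)].

Definition scons p (s : T) (c : seqT p) : seqT p.+1 :=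
  [ffun i => if unlift ord0 i is Some j then c j else s].

Definition nerve_dd p (c : seqT p.+1) : {ffun seqT p -> R^o} :=
  \sum_(i < p.+2) (-1) ^+ i *: unitv R (sface i c).

Definition nerve_based : based R T :=
  @Based R T seqT descending (fun p c => c ord0) nerve_dd.

Lemma descendingP p (c : seqT p) :
  reflect (forall i j : 'I_p.+1, (i <= j)%N -> le (c i) (c j)) (descending c).
Proof.
apply: (iffP forallP) => [h i j ij|h i].
  by have /forallP/(_ j)/implyP := h i; apply.
by apply/forallP=> j; apply/implyP/h.
Qed.

Lemma sface_descending p i (c : seqT p.+1) : descending c -> descending (sface i c).
Proof.
move=> /descendingP h; apply/descendingP=> j k jk; rewrite !ffunE.
exact/h/lift_mono.
Qed.

Lemma sface_le p i (c : seqT p.+1) : descending c -> le (c ord0) (sface i c ord0).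
Proof. by move=> /descendingP h; rewrite ffunE; apply: h. Qed.

Lemma scons0 p s (c : seqT p) : scons s c ord0 = s.
Proof. by rewrite ffunE unlift_none. Qed.

Lemma scons_lift p s (c : seqT p) j : scons s c (fintype.lift ord0 j) = c j.
Proof. by rewrite ffunE liftK. Qed.

Lemma scons_descending p s (c : seqT p) :
  descending c -> le s (c ord0) -> descending (scons s c).
Proof.
move=> /descendingP h sc; apply/descendingP=> i j.
case: (unliftP ord0 i) => [i'|] ->; case: (unliftP ord0 j) => [j'|] ->;
  rewrite ?scons0 ?scons_lift //.
- by rewrite /= /bump /= !add1n ltnS => /h.
- by move=> _; apply: le_tr sc _; apply: h.
Qed.

Lemma sface_scons0 p s (c : seqT p) : sface ord0 (scons s c) = c.
Proof. by apply/ffunP=> j; rewrite ffunE scons_lift. Qed.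

Lemma sface_sconsS p s (c : seqT p.+1) i :
  sface (fintype.lift ord0 i) (scons s c) = scons s (sface i c).
Proof.
apply/ffunP=> j; rewrite ffunE; case: (unliftP ord0 j) => [k|] ->.
  rewrite [RHS]scons_lift [RHS]ffunE -[RHS](scons_lift s c); congr (scons s c _).
  by apply: val_inj; rewrite /= bumpS.
rewrite [RHS]scons0 -[RHS](scons0 s c); congr (scons s c _).
exact: val_inj.
Qed.

Lemma sface_scons1 s (c : seqT 0) :
  sface (fintype.lift ord0 ord0) (scons s c) = [ffun=> s].
Proof.
apply/ffunP=> j; rewrite [LHS]ffunE [RHS]ffunE (ord1 j) -[RHS](scons0 s c).
by congr (scons s c _); apply: val_inj.
Qed.

Lemma scons_sface p (c : seqT p.+1) : scons (c ord0) (sface ord0 c) = c.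
Proof.
apply/ffunP=> i; case: (unliftP ord0 i) => [j|] ->; last exact: scons0.
by rewrite scons_lift ffunE.
Qed.

Lemma nerve_supp_unitv p (c : seqT p) :
  descending c -> supp le (X := nerve_based) (c ord0) (unitv R c).
Proof. exact: (supp_unitv le_refl (X := nerve_based)). Qed.

(** Prepending [s] to a chain over [s] gives a chain, and face 0 undoes it. In positive degree the
    other faces prepend [s] to a face of the old chain whose index is one less, hence the opposite
    sign; in degree 0 the other face is the apex. *)
Lemma nerve_contraction : contraction le nerve_based.
Proof.
have cst s : descending ([ffun=> s] : seqT 0).
  by apply/descendingP=> i j _; rewrite !ffunE.
exists (fun s => unitv R ([ffun=> s] : seqT 0))
       (fun s p c => unitv R (scons s c)) => /=.
- move=> p c cok; apply: supp_sum => i _; apply: suppZ.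
  apply: (supp_le le_tr (sface_le i cok)).
  exact/nerve_supp_unitv/sface_descending.
- by move=> s; have := nerve_supp_unitv (cst s); rewrite ffunE.
- by move=> s; apply: lext_unitv.
- move=> s p c cok sc; have := nerve_supp_unitv (scons_descending cok sc).
  by rewrite scons0.
- move=> s c _ _; rewrite [LHS]lext_unitv /= /nerve_dd big_ord_recl big_ord1.
  by rewrite sface_scons0 sface_scons1 scale1r scaleN1r.
- move=> s p c _ _; rewrite [LHS]lext_unitv /= /nerve_dd big_ord_recl.
  rewrite sface_scons0 scale1r; congr (_ + _).
  rewrite [lext _ _]linear_sum -sumrN; apply: eq_bigr => i _.
  by rewrite sface_sconsS linearZ /= lext_unitv exprS mulN1r scaleNr.
- move=> p c cok; exists (sface ord0 c); split.
  + exact: sface_descending.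
  + exact: sface_le.
  + by rewrite scons_sface.
Qed.

Variable F : modFunctor R (posetCat le_refl le_tr).

Definition nerve_chain p (c : seqT p) (h : descending c) :
    chain (posetCat le_refl le_tr) p :=
  @Chain (posetCat le_refl le_tr) p (fun i => c i)
    (fun i j ij => descendingP _ h i j (succ_leq ij)).

(** In a poset the morphisms are forced, so a symbol is determined by its objects and its first
    term. *)
Lemma push_coherent p (c : seqT p) (h : descending c) (l : fob F (c ord0)) :
  @coherent R _ F p (nerve_chain h) (fun i => push F (c ord0) (c i) l).
Proof.
move=> i j ij; have /descendingP hc := h.
have ij' := hc i j (succ_leq ij).
rewrite -(push_comp l (hc ord0 i (leq0n i)) ij') (pushE ij').
by congr (fmap F _ _); apply: bool_irrelevance.
Qed.

Definition nerve_simplex p (c : seqT p) (h : descending c) (l : fob F (c ord0)) :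
    simplex F p := mk_simplex (push_coherent h l).

Definition nerve_in_fun p (c : seqT p) (l : fob F (c ord0)) : nerve_lev F p :=
  match @idP (descending c) with
  | ReflectT h => proj _ << nerve_simplex h l >>
  | ReflectF _ => 0
  end.

Lemma nerve_in_linear p c : linear (@nerve_in_fun p c).
Proof.
move=> a l m; rewrite /nerve_in_fun; case: {-}_ / idP => [h|_]; last first.
  by rewrite scaler0 addr0.
rewrite -linearP; apply/projP/span_gen.
exists (nerve_chain h), a, (fun i => push F (c ord0) (c i) l).
exists (fun i => push F (c ord0) (c i) m), (push_coherent h l), (push_coherent h m).
congr (<< _ >> - _); apply: simplex_eq => i /=.
by rewrite /seq_of /= linearP.
Qed.
HB.instance Definition _ p (c : seqT p) :=
  GRing.isLinear.Build R (fob F (c ord0)) (nerve_lev F p) *:%R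
    (@nerve_in_fun p c) (@nerve_in_linear p c).

(** The terms of a symbol carry their objects, so the chain under it can be recognized; the
    transport brings the first term into [fob F (c ord0)]. *)
Definition nerve_out_gen p (c : seqT p) (s : simplex F p) : fob F (c ord0) :=
  match pselect (forall i, projT1 (sval s i) = c i) with
  | left e => eq_rect _ (fob F) (projT2 (sval s ord0)) _ (e ord0)
  | right _ => 0
  end.

(** The three symbols of an additivity relation share their objects, so either all are read off
    along the same transport or all give 0. *)
Lemma nerve_out_rel p (c : seqT p) z :
  @additive_rel R _ F p z -> flift (nerve_out_gen c) z = 0.
Proof.
move=> [d [a [l [m [hl [hm ->]]]]]].
rewrite linearB linearD linearZ /= !fglift_gen /nerve_out_gen /=.
case: pselect => [e|_]; last by rewrite scaler0 addr0 subrr.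
move: (c ord0) (e ord0) => t et; case: _ / et => /=.
by rewrite subrr.
Qed.

Definition nerve_out p (c : seqT p) : {linear nerve_lev F p -> fob F (c ord0)} :=
  quot_lift (@nerve_out_rel p c).
Arguments nerve_out : simpl never.

Lemma nerve_outE p (c : seqT p) s :
  nerve_out c (proj _ << s >>) = nerve_out_gen c s.
Proof. exact: etrans (quot_lift_funE (@nerve_out_rel p c) _) (fglift_gen _ _). Qed.

Lemma nerve_inE p (c : seqT p) (h : descending c) l :
  nerve_in_fun l = proj _ << nerve_simplex h l >>.
Proof.
rewrite /nerve_in_fun; case: {-}_ / idP => // h'.
by rewrite (bool_irrelevance h' h).
Qed.

Lemma existT_push s t s' t' (e : s = s') (l : fob F s) : t = t' ->
  existT (fob F) t' (push F s' t' (eq_rect s (fob F) l s' e)) =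
  existT (fob F) t (push F s t l).
Proof. by move=> et; case: _ / et; case: _ / e. Qed.

Lemma nerve_ins_outs p (a : nerve_lev F p) :
  \sum_(c : seqT p | descending c) nerve_in_fun (nerve_out c a) = a.
Proof.
pose S a := \sum_(c : seqT p | descending c) nerve_in_fun (nerve_out c a).
have S_linear b x y : S (b *: x + y) = b *: S x + S y.
  rewrite /S scaler_sumr -big_split; apply: eq_bigr => c _.
  by rewrite (linearP (nerve_out c)) (linearP (@nerve_in_fun p c)).
elim/quot_ind: a => z; elim/free_ind: z => [|b s z IH].
  by rewrite linear0 big1 // => c _; rewrite !linear0.
have -> : proj (@additive_rel R _ F p) (b *: << s >> + z) =
    b *: proj _ << s >> + proj _ z by exact: linearP.
rewrite [LHS]S_linear [S (proj _ z)]IH; congr (_ *: _ + _).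
rewrite /S {S S_linear b z IH}.
have [d [l [hl sE]]] := svalP s.
have -> : s = mk_simplex hl by apply: simplex_eq => i; rewrite sE.
(* Only the symbol's own sequence of objects contributes to the sum. *)
pose c : seqT p := [ffun i => cob d i].
have cE i : c i = cob d i by rewrite ffunE.
have cok : descending c.
  apply/descendingP=> i j ij; rewrite !cE.
  exact: (sval (chain_mor F d ij)).
rewrite (bigD1 c) // big1 => [|c' /andP[_ nc]]; last first.
  rewrite nerve_outE /nerve_out_gen; case: pselect => [e|_]; last exact: linear0.
  by case/eqP: nc; apply/ffunP=> i; rewrite cE -e.
rewrite [LHS]addr0 (nerve_inE cok).
apply: (congr1 (fun s => proj (@additive_rel R _ F p) << s >>)).
apply: simplex_eq => i.
rewrite nerve_outE /nerve_out_gen; case: pselect => [e|[]] //.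
rewrite /= /seq_of; apply: etrans (existT_push _ _ (esym (cE i))) _.
(* Coherence makes the i-th term the image of the first under a composite of the chain, so nothing
   is lost by keeping only the first. *)
have [g gl] := chain_mor F d (leq0n i : (ord0 <= i)%N).
congr existT; rewrite -(gl l hl) (pushE g).
by congr (fmap F _ _); apply: bool_irrelevance.
Qed.

Lemma nerve_outs_ins p (c : seqT p) l :
  descending c -> nerve_out c (nerve_in_fun l) = l.
Proof.
move=> h; rewrite (nerve_inE h) nerve_outE /nerve_out_gen.
case: pselect => [e|[]] //=.
by rewrite push_id (Prop_irrelevance (e ord0) erefl).
Qed.

Lemma nerve_outs_ins_neq p (c c' : seqT p) (l : fob F (c ord0)) :
  descending c -> c' != c -> nerve_out c' (nerve_in_fun l) = 0.
Proof.
move=> h cc; rewrite (nerve_inE h) nerve_outE /nerve_out_gen.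
case: pselect => [e|] //=; case/eqP: cc; apply/ffunP=> i.
by rewrite -e.
Qed.

(** Face 0 changes the base and replaces the first term by its image; the other faces keep the base,
    and there [push] is the identity. One formula covers both. *)
Lemma nerve_bd_ins p (c : seqT p.+1) (l : fob F (c ord0)) : descending c ->
  @bd R (Fnerve F) p (nerve_in_fun l) =
  lext (fun y : seqT p => nerve_in_fun (push F (c ord0) (y ord0) l)) (nerve_dd c).
Proof.
move=> h; rewrite (nerve_inE h) /bd linear_sum; apply: eq_bigr => i _.
rewrite linearZ /= lext_unitv; congr (_ *: _).
rewrite [LHS](quot_map_funE (nerve_map_rel (F := F) (lift_mono i))).
rewrite nerve_map_gen (nerve_inE (sface_descending i h)).
congr (proj _ << _ >>); apply: simplex_eq => j /=.
rewrite /seq_of /= push_comp ?sface_le //; last first.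
  by apply/descendingP => //; apply: sface_descending.
by rewrite ffunE.
Qed.

Lemma nerve_decomposition : decomposition F nerve_based (Fnerve F).
Proof.
exists (fun p (c : seqT p) =>
  (@nerve_in_fun p c : {linear fob F (c ord0) -> nerve_lev F p})) nerve_out.
- exact: nerve_ins_outs.
- exact: nerve_outs_ins.
- by move=> p c c' l cok _; apply: nerve_outs_ins_neq.
- exact: nerve_bd_ins.
Qed.

End NerveChains.

(** * The simplex *)

Section SimplexChains.
Variables (R : comNzRingType) (n : nat).
Implicit Types (s t : face n) (v u : 'I_n.+1).

Definition rank (A : {set 'I_n.+1}) v : nat := #|[set u in A | (u < v)%N]|.

(* [s] itself is returned when [s] is the single vertex [v]. *)
Definition fdel s v : face n := insubd s (val s :\ v).

Lemma fvert_proof v : [set v] != set0.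
Proof. by apply/set0Pn; exists v; rewrite set11. Qed.

Definition fvert v : face n := exist _ [set v] (fvert_proof v).

Lemma fadd_proof v s : v |: val s != set0.
Proof. by apply/set0Pn; exists v; rewrite setU11. Qed.

Definition fadd v s : face n := exist _ (v |: val s) (fadd_proof v s).

Lemma fdelE s v : (1 < #|val s|)%N -> val (fdel s v) = val s :\ v.
Proof.
move=> s1; rewrite val_insubd ifT // -card_gt0.
by rewrite (cardsD1 v) in s1; case: (v \in val s) s1 => //= /ltnW.
Qed.

Lemma fle_fdel s v : (1 < #|val s|)%N -> fle s (fdel s v).
Proof. by move=> s1; rewrite /fle fdelE // subD1set. Qed.

Lemma card_fdel s v p : #|val s| == p.+2 -> v \in val s ->
  #|val (fdel s v)| == p.+1.
Proof.
move=> /eqP sp vs; rewrite fdelE ?sp //.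
by move: sp; rewrite (cardsD1 v) vs add1n => -[->].
Qed.

Definition vmin s : 'I_n.+1 :=
  [arg min_(v < xchoose (set0Pn _ (valP s)) in val s) val v].

Lemma vminP s : vmin s \in val s /\ forall u, u \in val s -> (vmin s <= u)%N.
Proof. by rewrite /vmin; case: arg_minnP => //; apply: xchooseP. Qed.

Lemma rank_min (A : {set 'I_n.+1}) v :
  (forall u, u \in A -> (v <= u)%N) -> rank A v = 0%N.
Proof.
move=> h; apply/eqP; rewrite cards_eq0; apply/eqP/setP=> u; rewrite !inE.
by apply/negP => /andP[/h]; rewrite leqNgt => /negP.
Qed.

Definition simp_dd s : {ffun face n -> R^o} :=
  \sum_(v in val s) (-1) ^+ rank (val s) v *: unitv R (fdel s v).

(** One type serves all degrees, the dimension being fixed by [ok]. Each face is its own base, so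
    the value at [s] consists of the simplicial chains of [s]. *)
Definition simp_based : based R (face n) :=
  @Based R (face n) (fun=> face n) (fun p s => #|val s| == p.+1) (fun=> id)
    (fun=> simp_dd).

(* [vmin s] comes first in every face of [s] that contains it, so that adding
   it needs no sign. *)
Definition simp_cone s (p : nat) t : {ffun face n -> R^o} :=
  if vmin s \in val t then 0 else unitv R (fadd (vmin s) t).

Lemma simp_supp_unitv p s : #|val s| == p.+1 ->
  supp (@fle n) (X := simp_based) (p := p) s (unitv R s).
Proof. exact: (supp_unitv (@fle_refl n) (X := simp_based)). Qed.

(** The least vertex has rank 0, so omitting it gives [t] with sign +1; its presence raises the rank
    of each vertex of [t] by one and flips the other signs. *)
Lemma simp_dd_fadd s t : fle s t -> vmin s \notin val t ->
  simp_dd (fadd (vmin s) t) =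
  unitv R t - \sum_(v in val t) (-1) ^+ rank (val t) v *:
                unitv R (fdel (fadd (vmin s) t) v).
Proof.
move=> /subsetP ts st; have c1 : (1 < #|val (fadd (vmin s) t)|)%N.
  by rewrite /= cardsU1 st add1n ltnS card_gt0 (valP t).
have minlt v : v \in val t -> (vmin s < v)%N.
  move=> vt; rewrite ltn_neqAle (vminP s).2 ?ts // andbT.
  by apply: contraNneq st => /val_inj ->.
rewrite /simp_dd big_setU1 //=; congr (_ + _).
  have -> : rank (vmin s |: val t) (vmin s) = 0%N.
    by apply: rank_min => u; rewrite !inE => /predU1P[->|/minlt/ltnW].
  rewrite scale1r; congr (unitv R _); apply: val_inj.
  by rewrite fdelE //= setU1K.
rewrite -sumrN; apply: eq_bigr => v vt.
have -> : rank (vmin s |: val t) v = (rank (val t) v).+1.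
  rewrite /rank.
  have -> : [set u in vmin s |: val t | (u < v)%N] =
      vmin s |: [set u in val t | (u < v)%N].
    apply/setP=> u; rewrite !inE; case: eqP => [->|] //=.
    by rewrite minlt.
  by rewrite cardsU1 !inE (negbTE st) add1n.
by rewrite exprS mulN1r scaleNr.
Qed.

Lemma simp_contraction : contraction (@fle n) simp_based.
Proof.
exists (fun s => unitv R (fvert (vmin s))) simp_cone => /=.
- move=> p s sp; apply: supp_sum => v vs; apply: suppZ.
  apply: (supp_le (@fle_trans n)); last exact/simp_supp_unitv/card_fdel.
  by apply: fle_fdel; rewrite (eqP sp).
- move=> s; apply: (supp_le (@fle_trans n)); last first.
    by apply: simp_supp_unitv; rewrite /= cards1.
  by rewrite /fle /= sub1set (vminP s).1.
- by move=> s; apply: lext_unitv.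
- move=> s p t tp st; rewrite /simp_cone; case: ifP => [_|/negbT vt].
    exact: supp0.
  apply: (supp_le (@fle_trans n)); last first.
    by apply: simp_supp_unitv; rewrite /= cardsU1 vt (eqP tp).
  by rewrite /fle /= subUset sub1set (vminP s).1.
- move=> s t /cards1P[u tu'] st; have tu : val t = [set u] := tu'.
  rewrite /simp_cone; case: ifP => [vt|/negbT vt].
    (* The single vertex of [t] is the least one, so [t] is the apex and both sides vanish. *)
    rewrite linear0 (_ : t = fvert (vmin s)) ?subrr //; apply: val_inj.
    by move: vt; rewrite tu inE => /eqP ->.
  rewrite [LHS]lext_unitv [LHS]simp_dd_fadd //; congr (_ - _).
  rewrite tu big_set1 rank_min => [|w /set1P -> //].
  rewrite scale1r; congr (unitv R _); apply: val_inj; rewrite fdelE /=.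
    rewrite tu; apply/setP=> w; rewrite !inE; case: (w =P u) => [->|_] /=.
      by move: vt; rewrite tu inE eq_sym => /negbTE ->.
    by rewrite orbF.
  by rewrite cardsU1 vt tu cards1.
- move=> s p t tp st; have t1 : (1 < #|val t|)%N by rewrite (eqP tp).
  have tdel v : val (fdel t v) = val t :\ v by apply: fdelE.
  have -> : lext (simp_cone s p) (simp_dd t) = \sum_(v in val t)
      (-1) ^+ rank (val t) v *: simp_cone s p (fdel t v).
    rewrite [LHS]linear_sum; apply: eq_bigr => v _.
    by rewrite linearZ /= lext_unitv.
  have [vt|vt] := boolP (vmin s \in val t).
    (* The cone over [t] is 0, and in the cone over its boundary only the face omitting the least
       vertex survives; its cone is [t], with sign +1. *)
    rewrite (bigD1 (vmin s)) // big1 => [|v /andP[_ vs]]; last first.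
      by rewrite /simp_cone tdel in_setD1 vt eq_sym vs scaler0.
    rewrite [LHS](_ : _ = 0); last by rewrite /simp_cone vt linear0.
    rewrite /= addr0 /simp_cone tdel in_setD1 eqxx rank_min /=; last first.
      by move=> u /(subsetP st); apply: (vminP s).2.
    rewrite scale1r (_ : fadd _ _ = t) ?subrr //; apply: val_inj => /=.
    by rewrite tdel setD1K.
  rewrite [in LHS]/simp_cone (negbTE vt) [LHS]lext_unitv [LHS]simp_dd_fadd //.
  congr (_ - _); apply: eq_bigr => v vt'; congr (_ *: _).
  rewrite /simp_cone tdel in_setD1 (negbTE vt) andbF.
  have vv : vmin s != v by apply: contraNneq vt => ->.
  congr (unitv R _); apply: val_inj; rewrite fdelE /= ?tdel.
    by apply/setP=> u; rewrite !inE; case: (u =P vmin s) => [->|_] //=; rewrite vv.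
  by rewrite cardsU1 vt; apply: leqW.
- move=> p s sp; exists (fdel s (vmin s)).
  have s1 : (1 < #|val s|)%N by rewrite (eqP sp).
  have vs := (vminP s).1; split; [exact: card_fdel | exact: fle_fdel |].
  rewrite /simp_cone fdelE // !inE eqxx /=; congr (unitv R _).
  by apply: val_inj; rewrite /= fdelE // setD1K.
Qed.

End SimplexChains.

(** Sets of ordinals are enumerated in increasing order. This turns the index of a face operator of
    [Fnabla] into the number of letters A before the erased one. *)
Lemma card_lt_enum_val n (A : {set 'I_n}) (i : 'I_#|A|) :
  #|[set k in A | (k < enum_val i)%N]| = i.
Proof.
have As : sorted <%O (map val (enum A)).
  rewrite ltEnat; apply: (subseq_sorted ltn_trans) (iota_ltn_sorted 0 n).
  by rewrite -val_enum_ord map_subseq // enumT filter_subseq.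
have iA : (i < size (map val (enum A)))%N by rewrite size_map -cardE.
rewrite -[RHS](Order.POrderTheory.count_lt_nth 0%N As iA) count_map cardE.
rewrite -size_filter; congr size.
rewrite [in RHS]/enum_mem -filter_predI /enum_mem; apply: eq_filter => k.
rewrite !inE andbC /= ltEnat /= (nth_map (enum_val i)) -?cardE //.
by rewrite -enum_val_nth.
Qed.

(** * Extension by zero *)

Section OnlyIfMaps.
Variables (R : comNzRingType) (b : bool) (M : lmodType R).

Definition to_only_if : {linear M -> only_if b M} :=
  match b with true => idfun | false => \0 end.

Definition from_only_if : {linear only_if b M -> M} :=
  match b with true => idfun | false => \0 end.

Lemma from_only_ifK : cancel from_only_if to_only_if.
Proof.
rewrite /to_only_if /from_only_if; case: b => // x.
by apply/rowP; case.
Qed.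

Lemma to_only_ifK (x : M) : from_only_if (to_only_if x) = if b then x else 0.
Proof. by rewrite /to_only_if /from_only_if; case: b. Qed.

Lemma only_if0 (x : only_if b M) : b = false -> x = 0.
Proof. by move: x; rewrite /only_if; case: b => // x _; apply/rowP; case. Qed.
End OnlyIfMaps.

Lemma from_only_if_map (R : comNzRingType) b b' (M N : lmodType R)
    (f : {linear M -> N}) x :
  from_only_if b' N (only_if_map b b' f x) =
  if b' then f (from_only_if b M x) else 0.
Proof. by case: b x; case: b' => //= x; rewrite linear0. Qed.

(** * Words as the faces that contain vertex 0 *)

Section FacesAndWords.
Variable n : nat.
Implicit Types (s t : face n) (w : word n).

Definition vertices w : {set 'I_n.+1} :=
  ord0 |: [set fintype.lift ord0 j | j in [set j | w j]].

Lemma vertices_neq0 w : vertices w != set0.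
Proof. by apply/set0Pn; exists ord0; rewrite setU11. Qed.

Definition face_of_word w : face n := exist _ (vertices w) (vertices_neq0 w).

Lemma lift0_neq0 (j : 'I_n) : (fintype.lift ord0 j == ord0 :> 'I_n.+1) = false.
Proof. by rewrite eq_sym (negbTE (neq_lift _ _)). Qed.

Lemma ord0_face_of_word w : ord0 \in val (face_of_word w).
Proof. by rewrite /= setU11. Qed.

Lemma face_of_wordK : cancel face_of_word (@word_of_face n).
Proof.
move=> w; apply/ffunP=> j; rewrite ffunE /= in_setU1.
by rewrite lift0_neq0 mem_imset ?inE //; apply: lift_inj.
Qed.

Lemma word_of_faceK s : ord0 \in val s -> face_of_word (word_of_face s) = s.
Proof.
move=> s0; apply: val_inj; apply/setP=> v; rewrite in_setU1.
case: (unliftP ord0 v) => [j|] ->; last by rewrite eqxx.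
by rewrite lift0_neq0 mem_imset ?inE ?ffunE //; apply: lift_inj.
Qed.

Lemma card_face_of_word w : #|val (face_of_word w)| = (nA w).+1.
Proof.
rewrite /= cardsU1 card_imset; last exact: lift_inj.
rewrite (_ : ord0 \notin _) //; apply/imsetP=> -[j _ /esym/eqP].
by rewrite lift0_neq0.
Qed.

Lemma nA_word_of_face s : ord0 \in val s -> #|val s| = (nA (word_of_face s)).+1.
Proof. by move=> s0; rewrite -card_face_of_word word_of_faceK. Qed.

Lemma word_of_fdel s (j : 'I_n) : (1 < #|val s|)%N ->
  word_of_face (fdel s (fintype.lift ord0 j)) = eraseA (word_of_face s) j.
Proof.
move=> s1; apply/ffunP=> i; rewrite !ffunE fdelE // in_setD1.
by rewrite (inj_eq lift_inj); case: eqP.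
Qed.

(** The extra one counts vertex 0, which precedes the vertices of all crossings. *)
Lemma rank_lift s (j : 'I_n) : ord0 \in val s ->
  rank (val s) (fintype.lift ord0 j) =
  (#|[set k in [set k | word_of_face s k] | (k < j)%N]|).+1.
Proof.
move=> s0; rewrite -(card_imset _ (@lift_inj _ (@ord0 n))) /rank.
have -> : [set u in val s | (u < fintype.lift ord0 j)%N] =
    ord0 |: [set fintype.lift ord0 k | k in
               [set k in [set k | word_of_face s k] | (k < j)%N]].
  apply/setP=> v; rewrite !inE; case: (unliftP ord0 v) => [k|] ->.
    rewrite lift0_neq0 mem_imset; last exact: lift_inj.
    by rewrite !inE ffunE /= /bump !add1n ltnS.
  by rewrite s0 eqxx.
rewrite cardsU1 (_ : ord0 \notin _) ?add1n //.
by apply/imsetP=> -[k _ /esym/eqP]; rewrite lift0_neq0.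
Qed.

End FacesAndWords.

(** * Decomposition of [Fnabla] over the faces of the simplex *)

Section NablaFaces.
Variables (R : comNzRingType) (n : nat) (F : modFunctor R (cube n)).
Implicit Types (w : word n) (s t : face n).

(** Words with the wrong number of letters A are sent to 0, so that every word can serve as an
    index. *)
Definition word_in p w : {linear fob F w -> nabla_lev F p} :=
  match @idP (nA w == p) with
  | ReflectT h => let v : kword n p := exist _ w h in
      (@dinj R _ (@summand R n F p) v : {linear summand F v -> nabla_lev F p})
  | ReflectF _ => \0
  end.

Definition dproj p (v : kword n p) (x : nabla_lev F p) : summand F v := x v.

Lemma dproj_linear p v : linear (@dproj p v).
Proof. by []. Qed.
HB.instance Definition _ p v :=
  GRing.isLinear.Build R (nabla_lev F p) (summand F v) *:%R (@dproj p v)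
    (@dproj_linear p v).

Definition word_out p w : {linear nabla_lev F p -> fob F w} :=
  match @idP (nA w == p) with
  | ReflectT h => let v : kword n p := exist _ w h in
      (@dproj p v : {linear nabla_lev F p -> summand F v})
  | ReflectF _ => \0
  end.

Lemma word_inE p w (h : nA w == p) x :
  word_in p w x = @dinj R _ (@summand R n F p) (exist _ w h) x.
Proof.
by rewrite /word_in; case: {-}_ / idP => // h'; rewrite (bool_irrelevance h' h).
Qed.

Lemma word_outE p w (h : nA w == p) a : word_out p w a = a (exist _ w h).
Proof.
by rewrite /word_out; case: {-}_ / idP => // h'; rewrite (bool_irrelevance h' h).
Qed.

Lemma word_inK p w x : nA w == p -> word_out p w (word_in p w x) = x.
Proof. by move=> h; rewrite (word_inE h) (word_outE h) dinj_same. Qed.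

Lemma word_in_neq p w w' (x : fob F w) : w' != w -> word_out p w' (word_in p w x) = 0.
Proof.
move=> ww; rewrite /word_out /word_in.
case: {-}_ / idP => [h'|_]; last by [].
case: {-}_ / idP => [h|_]; last by [].
by rewrite [LHS]dinj_other.
Qed.

Lemma word_in_out p w a (v : kword n p) :
  word_in p w (word_out p w a) v = if w == val v then a v else 0.
Proof.
case: eqP => [e|wv].
  have h : nA w == p by rewrite e; apply: (valP v).
  rewrite (word_inE h) (word_outE h).
  have -> : v = exist _ w h by apply: val_inj.
  by rewrite dinj_same.
rewrite /word_in; case: {-}_ / idP => [h|_] //.
by rewrite [LHS]dinj_other //; apply/eqP=> e; apply: wv; rewrite e.
Qed.

Lemma word_in_fmap p u w w' (h : wle u w) (h' : wle u w') (x : fob F u) : w = w' ->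
  word_in p w (fmap F (h : hom (cube n) u w) x) =
  word_in p w' (fmap F (h' : hom (cube n) u w') x).
Proof. by move=> e; case: _ / e h' => h'; rewrite (bool_irrelevance h h'). Qed.

(** d_0 is zero, and the other operators are reindexed by the erased crossing instead of its
    position. Positions start at 0 but these operators at d_1, whence the successor in the
    exponent. *)
Lemma bd_word_in p w (x : fob F w) : nA w == p.+1 ->
  @bd R (Fnabla F) p (word_in p.+1 w x) =
  \sum_(j | w j) (-1) ^+ (#|[set k in [set k | w k] | (k < j)%N]|).+1 *:
     word_in p (eraseA w j) (fmap F (eraseA_le w j : hom (cube n) _ _) x).
Proof.
move=> h; rewrite (word_inE h) /bd big_ord_recl /= {1}/nabla_fac unlift_none.
rewrite scaler0 add0r.
transitivity (\sum_(j in [set j | w j])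
    (-1) ^+ (#|[set k in [set k | w k] | (k < j)%N]|).+1 *:
    word_in p (eraseA w j) (fmap F (eraseA_le w j : hom (cube n) _ _) x)).
  rewrite [RHS]big_enum_val.
  pose e : #|[set j | w j]| = p.+1 := eqP h.
  rewrite [RHS](reindex (cast_ord (esym e))); last first.
    apply: onW_bij; exists (cast_ord e).
      exact: cast_ordKV.
    exact: cast_ordK.
  apply: eq_bigr => i _; rewrite card_lt_enum_val /=; congr (_ *: _).
  rewrite /nabla_fac liftK [LHS]erase_dinj.
  apply: etrans (esym (word_inE (erase_proof (exist _ w h : kword n p.+1) i) _)) _.
  apply: word_in_fmap; congr (eraseA w _).
  by congr (enum_val (cast_ord _ i)); apply: eq_irrelevance.
by apply: eq_bigl => j; rewrite inE.
Qed.

Definition nabla_in p s : {linear fob (extend F) s -> nabla_lev F p} :=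
  word_in p (word_of_face s) \o from_only_if (ord0 \in val s) _.

Definition nabla_out p s : {linear nabla_lev F p -> fob (extend F) s} :=
  to_only_if (ord0 \in val s) _ \o word_out p (word_of_face s).

Lemma nA_ok p s : ord0 \in val s -> #|val s| == p.+1 -> nA (word_of_face s) == p.
Proof. by move=> /nA_word_of_face ->. Qed.

Lemma nabla_in_out p s a : nabla_in p s (nabla_out p s a) =
  if ord0 \in val s then word_in p _ (word_out p (word_of_face s) a) else 0.
Proof.
rewrite /nabla_in /nabla_out /= to_only_ifK; case: ifP => // _.
exact: linear0.
Qed.

Lemma nabla_ins_outs p (a : nabla_lev F p) :
  \sum_(s : face n | #|val s| == p.+1) nabla_in p s (nabla_out p s a) = a.
Proof.
apply/functional_extensionality_dep => v.
transitivity (\sum_(s : face n | #|val s| == p.+1)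
    nabla_in p s (nabla_out p s a) v); first exact: (linear_sum (dproj v)).
(* At the word [v] only its own face contributes: other faces with vertex 0 carry other words, and
   those without it carry the zero module. *)
rewrite (bigD1 (face_of_word (val v))); last first.
  by rewrite /= card_face_of_word (eqP (valP v)).
rewrite nabla_in_out ord0_face_of_word word_in_out face_of_wordK eqxx.
rewrite big1 => [|s /andP[_ sv]]; first exact: addr0.
rewrite nabla_in_out; case: ifP => [s0|_] //.
rewrite word_in_out ifN //; apply: contraNneq sv => <-.
by rewrite word_of_faceK.
Qed.

Lemma nabla_outs_ins p s (l : fob (extend F) s) :
  #|val s| == p.+1 -> nabla_out p s (nabla_in p s l) = l.
Proof.
move=> sp; rewrite /nabla_in /nabla_out /=.
case/orP: (orbN (ord0 \in val s)) => s0.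
  by rewrite word_inK ?from_only_ifK // nA_ok.
by rewrite [l]only_if0 ?(negbTE s0) // !linear0.
Qed.

Lemma nabla_outs_ins_neq p s t (l : fob (extend F) s) :
  t != s -> nabla_out p t (nabla_in p s l) = 0.
Proof.
move=> ts; rewrite /nabla_in /nabla_out /=.
case/orP: (orbN (ord0 \in val s)) => s0; last first.
  by rewrite [l]only_if0 ?(negbTE s0) // !linear0.
case/orP: (orbN (ord0 \in val t)) => t0; last first.
  by rewrite [LHS]only_if0 ?(negbTE t0).
rewrite word_in_neq ?linear0 //; apply: contraNneq ts => e.
by rewrite -(word_of_faceK s0) -(word_of_faceK t0) e.
Qed.

Lemma nabla_in_push p s t (h : fle s t) (l : fob (extend F) s) :
  nabla_in p t (push (extend F) s t l) =
  if ord0 \in val t then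
    word_in p _ (fmap F (word_of_face_le h : hom (cube n) _ _)
                        (from_only_if (ord0 \in val s) _ l))
  else 0.
Proof.
rewrite (pushE (F := extend F) h) /nabla_in /=.
rewrite [X in word_in _ _ X = _]from_only_if_map.
by case: ifP => // _; rewrite linear0.
Qed.

(** Omitting vertex 0 leads to a face where the extension vanishes, which matches d_0 = 0. The other
    vertices correspond to erased letters, with signs matched by [rank_lift]. *)
Lemma nabla_bd_ins p s (l : fob (extend F) s) : #|val s| == p.+2 ->
  @bd R (Fnabla F) p (nabla_in p.+1 s l) =
  lext (fun t : face n => nabla_in p t (push (extend F) s t l)) (simp_dd R s).
Proof.
move=> sp; have s1 : (1 < #|val s|)%N by rewrite (eqP sp).
transitivity (\sum_(v in val s) (-1) ^+ rank (val s) v *: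
    nabla_in p (fdel s v) (push (extend F) s (fdel s v) l)); last first.
  rewrite [RHS]linear_sum; apply: eq_bigr => v _.
  by rewrite linearZ /= lext_unitv.
case/orP: (orbN (ord0 \in val s)) => s0; last first.
  (* A face without vertex 0 carries the zero module, so both sides vanish. *)
  by rewrite [l]only_if0 ?(negbTE s0) // !linear0 big1 // => v _; rewrite !linear0.
pose x := from_only_if (ord0 \in val s) _ l.
have -> : nabla_in p.+1 s l = word_in p.+1 (word_of_face s) x by [].
transitivity (\sum_(v in val s) (-1) ^+ rank (val s) v *:
    if ord0 \in val s :\ v then
      word_in p (word_of_face (fdel s v))
        (fmap F (word_of_face_le (fle_fdel v s1) : hom (cube n) _ _) x)
    else 0); last first.
  apply: eq_bigr => v _; congr (_ *: _); rewrite -fdelE //.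
  exact: esym (nabla_in_push p (fle_fdel v s1) l).
rewrite bd_word_in ?nA_ok // big_mkcond [RHS]big_mkcond big_ord_recl s0.
rewrite setD11 scaler0 [RHS]add0r; apply: eq_bigr => j _.
rewrite ffunE; case: ifP => // js; rewrite rank_lift //; congr (_ *: _).
rewrite in_setD1 s0 eq_sym lift0_neq0 /=; apply: word_in_fmap.
by rewrite word_of_fdel.
Qed.

Lemma nabla_decomposition :
  decomposition (le_refl := @fle_refl n) (le_tr := @fle_trans n)
    (extend F) (simp_based R n) (Fnabla F).
Proof.
exists nabla_in nabla_out => /=.
- exact: nabla_ins_outs.
- exact: nabla_outs_ins.
- by move=> p s t l _ _; apply: nabla_outs_ins_neq.
- exact: nabla_bd_ins.
Qed.

End NablaFaces.

Theorem mainTheorem3 (R : comNzRingType) (V : comAlgType R)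
    (fr : frobenius V) (n : nat) (K : diagram n) (F : stateFunctor fr K)
    (p : nat) :
  [/\ KhoH F p = homology (Fnabla F) p,
      lmod_iso (homology (Fnabla F) p) (homology (Fnerve (extend F)) p)
    & lmod_iso (homology (Fnerve (extend F)) p) (cat_homology (extend F) p)].
Proof.
(* The first and third clauses hold by definition; the second compares two decompositions over the
   poset of faces. *)
split=> //; last by exists idfun, idfun.
apply: (acyclic_homology_iso (le_refl := @fle_refl n) (le_tr := @fle_trans n)
  p _ _ (nabla_decomposition F) (nerve_decomposition (extend F))).
- exact: contraction_acyclic (@fle_trans n) _ (simp_contraction R n).
- exact: contraction_acyclic (@fle_trans n) _
    (nerve_contraction R (@fle_refl n) (@fle_trans n)).
Qed.
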